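(* Let $h\ge 2$ be an integer, $\underline{\ell}=(\ell_1,\ldots,\ell_h)\in\mathbb{Z}_{>0}^h$, and let $B_{\underline{\ell},h}$ be the associated bipartite graph. (1) If $\ell_1=\ell_2=\cdots=\ell_h=:\ell$, then for all $i,j\ge0$ $$\beta_{i,j}(I_{B_{\underline{\ell},h}})=\beta_{i,j}(\mathrm{in}_\prec(I_{B_{\underline{\ell},h}}))=\begin{cases}(i+1)\binom{h}{i+2}, & j=\ell(i+2),\\ 0,&\text{otherwise.}\end{cases}$$ (2) If $\ell_1\ne\ell_2=\cdots=\ell_h$, then, with $q=\ell_1$ and $\ell=\ell_2$, for all $i,j\ge0$ $$\beta_{i,j}(I_{B_{\underline{\ell},h}})=\beta_{i,j}(\mathrm{in}_\prec(I_{B_{\underline{\ell},h}}))=\begin{cases}(i+1)\binom{h-1}{i+2}, & j=\ell(i+2),\\ (h-1)\binom{h-2}{i}, & j=\ell(i+1)+q,\\ 0,&\text{otherwise.}\end{cases}$$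
   Context: $\mathbb{K}$ is a field. The graph $B_{\underline{\ell},h}$ consists of $h$ paths of lengths $2\ell_1,\ldots,2\ell_h$ from a common vertex $y_1$ to another common vertex $y_2$, the paths being otherwise disjoint: its vertices are $y_1,y_2$ and $x_{i,j}$ for $1\le j\le h$, $1\le i\le 2\ell_j-1$, and its edges are $e_{1,j}=\{y_1,x_{1,j}\}$, $e_{i,j}=\{x_{i-1,j},x_{i,j}\}$ for $2\le i\le 2\ell_j-1$, and $e_{2\ell_j,j}=\{x_{2\ell_j-1,j},y_2\}$, for $1\le j\le h$. For a simple graph $G$ with edge set $E$, the toric ideal $I_G$ is the kernel of the $\mathbb{K}$-algebra map from the polynomial ring $\mathbb{K}[E]$ (variables indexed by edges) to the polynomial ring on the vertices, sending an edge $\{a,b\}$ to $ab$. Here $R=\mathbb{K}[e_{i,j}: 1\le j\le h,\ 1\le i\le 2\ell_j]$, standard graded, and $\beta_{i,j}(M)=\dim_{\mathbb{K}}\mathrm{Tor}_i^R(M,\mathbb{K})_j$. $\prec$ is the pure lexicographic monomial order on $R$ induced by the following order of variables: $e_{i_1,j_1}\succ e_{i_2,j_2}$ if and only if either $i_1$ is odd and $i_2$ is even, or $i_1\equiv i_2 \pmod 2$ and $i_1<i_2$, or $i_1=i_2$ and $j_1<j_2$. Binomial coefficients $\binom{r}{i}$ are $0$ for $i>r$. *)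

(* Defs.v *)
From HB Require Import structures.
From mathcomp Require Import all_boot all_order all_algebra zify.
From mathcomp Require Import mpoly.
From Stdlib Require Import ClassicalEpsilon.

Set Implicit Arguments.
Unset Strict Implicit.
Unset Printing Implicit Defensive.

Import GRing.Theory.
Local Open Scope ring_scope.

(* Ideals are predicates on {mpoly K[n]}. *)

Definition ideal_gen (R : comNzRingType) (S : R -> Prop) (p : R) : Prop :=
  exists s : seq (R * R),
    (forall cg, cg \in s -> S cg.2) /\ p = \sum_(cg <- s) cg.1 * cg.2.

Section GradedBetti.

Variables (K : fieldType) (n : nat).
Local Notation R := {mpoly K[n]}.

(* Graded free resolution  ... -> F_1 -> F_0 -> I -> 0  with
   F_i = \bigoplus_a R(- res_deg i a).  Elements of F_i are row vectors, so the
   maps act by multiplication on the right.  The homogeneity conditions say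
   that a nonzero entry (a, b) of F_(i+1) -> F_i is homogeneous of degree
   res_deg i.+1 a - res_deg i b. *)
Record graded_free_resolution (I : R -> Prop) := GradedFreeResolution {
  res_rk : nat -> nat;
  res_deg : forall i, 'I_(res_rk i) -> nat;
  res_aug : 'cV[R]_(res_rk 0);
  res_dif : forall i, 'M[R]_(res_rk i.+1, res_rk i);
  res_aug_homog : forall a m,
    m \in msupp (res_aug a ord0) -> mdeg m = res_deg a;
  res_dif_homog : forall i a b m,
    m \in msupp (res_dif i a b) -> (mdeg m + res_deg b)%N = res_deg a;
  res_exact_aug : forall p,
    I p <-> exists v : 'rV[R]_(res_rk 0), (v *m res_aug) ord0 ord0 = p;
  res_exact0 : forall v : 'rV[R]_(res_rk 0),
    v *m res_aug = 0 <-> exists w, w *m res_dif 0 = v;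
  res_exactS : forall i (v : 'rV[R]_(res_rk i.+1)),
    v *m res_dif i = 0 <-> exists w, w *m res_dif i.+1 = v
}.

Section Tor.

Variables (I : R -> Prop) (F : graded_free_resolution I).

(* F_(i+1) (x)_R K -> F_i (x)_R K, where K = R / ('X_0, .., 'X_(n-1)). *)
Definition tensor_dif i : 'M[K]_(res_rk F i.+1, res_rk F i) :=
  map_mx (mcoeff 0%MM) (res_dif F i).

(* The row space is the degree j part of F_i (x)_R K. *)
Definition tensor_part i j : 'M[K]_(res_rk F i) :=
  diag_mx (\row_a (res_deg a == j)%:R).

Definition tensor_cycles i j : 'M[K]_(res_rk F i) :=
  match i with
  | 0 => tensor_part 0 j
  | i'.+1 => (tensor_part i'.+1 j :&: kermx (tensor_dif i'))%MS
  end.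

Definition tensor_boundaries i j : 'M[K]_(res_rk F i.+1, res_rk F i) :=
  tensor_part i.+1 j *m tensor_dif i.

(* dim_K H_i(F (x)_R K)_j *)
Definition tor_dim i j : nat :=
  (\rank (tensor_cycles i j) - \rank (tensor_boundaries i j))%N.

End Tor.

(* dim_K Tor_i^R(I, K)_j, computed from some graded free resolution. *)
Definition betti (I : R -> Prop) (i j : nat) : nat :=
  epsilon (inhabits 0%N)
    (fun b => exists F : graded_free_resolution I, tor_dim F i j = b).

End GradedBetti.

Section InitialIdeal.

Variables (K : fieldType) (n : nat) (gt : rel 'I_n).

(* [gt k k'] means that the variable 'X_k is larger than 'X_k'. *)
Definition lex_lt (m1 m2 : 'X_{1..n}) : Prop :=
  exists2 k, (m1 k < m2 k)%N & forall k', gt k' k -> m1 k' = m2 k'.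

Definition leading_monomial (f : {mpoly K[n]}) (m : 'X_{1..n}) : Prop :=
  m \in msupp f /\
  forall m', m' \in msupp f -> m' != m -> lex_lt m' m.

Definition initial_ideal (I : {mpoly K[n]} -> Prop) : {mpoly K[n]} -> Prop :=
  ideal_gen (fun g => exists f m, [/\ I f, leading_monomial f m & g = 'X_[m]]).

End InitialIdeal.

Record simple_graph := SimpleGraph {
  vertex : finType;
  edge : finType;
  ends : edge -> {set vertex};
  card_ends : forall e, #|ends e| = 2;
  ends_inj : injective ends
}.

(* The variables of K[E] and K[V] are numbered by [enum_rank]. *)
Definition toric_map (K : fieldType) (G : simple_graph) :
    {mpoly K[#|edge G|]} -> {mpoly K[#|vertex G|]} :=
  comp_mpoly
    [tuple \prod_(v in ends (enum_val k)) 'X_(enum_rank v) | k < #|edge G|].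

Definition toric_ideal (K : fieldType) (G : simple_graph)
    (f : {mpoly K[#|edge G|]}) : Prop :=
  toric_map f = 0.

Section PathGraph.

Local Open Scope nat_scope.

Variables (h : nat) (l : 'I_h -> nat).

(* inl false = y_1, inl true = y_2, and inr (Tagged _ k) with k : 'I_(2 l_j - 1)
   is x_{k+1,j}. *)
Definition B_vertex : finType := (bool + {j : 'I_h & 'I_(2 * l j).-1})%type.

(* Tagged _ k with k : 'I_(2 l_j) is e_{k+1,j}. *)
Definition B_edge : finType := {j : 'I_h & 'I_(2 * l j)}.

(* The vertex at distance p from y_1 on the j-th path, for p <= 2 l_j. *)
Definition path_vertex (j : 'I_h) (p : nat) : B_vertex :=
  if p == 0 then inl false
  else if insub p.-1 is Some k
       then inr (@Tagged _ j (fun j => 'I_(2 * l j).-1) k)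
       else inl true.

Definition B_ends (e : B_edge) : {set B_vertex} :=
  [set path_vertex (tag e) (tagged e); path_vertex (tag e) (tagged e).+1].

(* e_{i1,j1} > e_{i2,j2}, with i1, i2 starting from 1 *)
Definition edge_gt (e1 e2 : B_edge) : bool :=
  let i1 := (tagged e1).+1 in let i2 := (tagged e2).+1 in
  [|| odd i1 && ~~ odd i2,
      (odd i1 == odd i2) && (i1 < i2)
    | (i1 == i2) && (tag e1 < tag e2)].

Definition vertex_level (j : 'I_h) (v : B_vertex) : nat :=
  match v with
  | inl b => if b then 2 * l j else 0
  | inr u => (tagged u).+1
  end.

Definition vertex_path (v : B_vertex) : option 'I_h :=
  if v is inr u then Some (tag u) else None.

Lemma path_vertexK j p : p <= 2 * l j -> vertex_level j (path_vertex j p) = p.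
Proof.
rewrite /path_vertex; case: eqP => [-> //|/eqP p_neq0] le_p.
case: insubP => [u _ /= -> | ] /=; lia.
Qed.

Lemma path_path_vertex j p :
  0 < p < 2 * l j -> vertex_path (path_vertex j p) = Some j.
Proof.
rewrite /path_vertex => /andP[p_gt0 lt_p]; rewrite gtn_eqF //.
by case: insubP => //= /negP[]; lia.
Qed.

Lemma path_vertex_inj j j' p p' : 0 < p < 2 * l j -> p' <= 2 * l j' ->
  path_vertex j p = path_vertex j' p' -> j = j' /\ p = p'.
Proof.
move=> p_int le_p' eq_v; have := path_path_vertex p_int; rewrite eq_v => path_v.
have ejj' : j = j'.
  move: path_v; rewrite /path_vertex; case: ifP => //= _.
  by case: insubP => //= u _ _ [].
split=> //; rewrite -ejj' in eq_v le_p'.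
have le_p : p <= 2 * l j by lia.
by rewrite -(path_vertexK le_p) eq_v path_vertexK.
Qed.

Lemma card_B_ends e : #|B_ends e| = 2.
Proof.
rewrite cards2; case: eqP => // eq_v; have lt_e := ltn_ord (tagged e).
have := path_vertexK lt_e; rewrite -eq_v path_vertexK; lia.
Qed.

Lemma B_ends_inj : (forall j, 0 < l j) -> injective B_ends.
Proof.
move=> l_gt0 [j k] [j' k'] /setP eq_e.
have lt_k := ltn_ord k; have lt_k' := ltn_ord k'; have := l_gt0 j => lj_gt0.
have mem (p : nat) : (p == k :> nat) || (p == k.+1) -> 0 < p < 2 * l j ->
    j = j' /\ ((p == k' :> nat) || (p == k'.+1)).
  move=> p_end p_int; have := eq_e (path_vertex j p).
  rewrite !inE /=.
  have -> : (path_vertex j p == path_vertex j k)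
          || (path_vertex j p == path_vertex j k.+1).
    by case/orP: p_end => /eqP->; rewrite eqxx ?orbT.
  case/esym/orP => /eqP/path_vertex_inj; case=> //; do ?lia.
  - by move=> -> ->; rewrite eqxx.
  - by move=> -> ->; rewrite eqxx orbT.
have ejj' : j = j'.
  have [lt1|ge1] := ltnP k.+1 (2 * l j); first by case: (mem k.+1); rewrite ?eqxx ?orbT.
  by case: (mem k); rewrite ?eqxx //; lia.
move: k' lt_k' eq_e {mem}; case: _ / ejj' => k' lt_k' eq_e.
have sub (a b : 'I_(2 * l j)) :
    (forall v, (v \in B_ends (Tagged _ a)) = (v \in B_ends (Tagged _ b))) ->
    (a == b :> nat) || (a == b.+1 :> nat).
  move=> eq_ab; have lt_a := ltn_ord a; have lt_b := ltn_ord b.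
  have := eq_ab (path_vertex j a); rewrite !inE eqxx /= => /esym.
  have le_a : a <= 2 * l j by lia.
  have le_b : b <= 2 * l j by lia.
  case/orP=> /eqP eq_v; have := path_vertexK le_a;
    rewrite eq_v path_vertexK // => ->; by rewrite eqxx ?orbT.
have := sub k k' eq_e; have := sub k' k (fun v => esym (eq_e v)) => H1 H2.
by congr (Tagged _ _); apply: val_inj => /=; lia.
Qed.

Definition B_graph (l_gt0 : forall j, 0 < l j) : simple_graph :=
  SimpleGraph card_B_ends (B_ends_inj l_gt0).

End PathGraph.

Definition B_var_gt (h : nat) (l : 'I_h -> nat) (l_gt0 : forall j, (0 < l j)%N) :
    rel 'I_#|edge (B_graph l_gt0)| :=
  fun k k' => edge_gt (enum_val k : B_edge l) (enum_val k' : B_edge l).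
Arguments B_var_gt {h l} l_gt0 _ _.

(* Main.v *)
Require Import Defs.
From HB Require Import structures.
From mathcomp Require Import all_boot all_order all_algebra zify ring.
From mathcomp Require Import mpoly.
From Stdlib Require Import ClassicalEpsilon.

Set Implicit Arguments.
Unset Strict Implicit.
Unset Printing Implicit Defensive.

Import GRing.Theory.
Local Open Scope ring_scope.

(** Let a_j and b_j be the products of the edges of odd and of even index on the
    j-th path: monomials of degree l_j, in disjoint sets of variables. The cycle
    through two paths j and k gives the binomial a_j b_k - a_k b_j, so the toric
    ideal is the ideal of 2-minors of the 2-by-h matrix with rows (a_j) and
    (b_j), and its initial ideal is generated by the a_j b_k with j < k. Both
    facts come from one observation: every fibre of the toric map contains
    exactly one monomial divisible by no a_j b_k with j < k
    ([standard_unique]), and replacing a_j b_k by a_k b_j leads to it while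
    descending in the lexicographic order ([reduce_monomial]).

    The ideal of minors is resolved by the Eagon-Northcott complex. In step i
    its basis consists of the pairs (S, p) of a set S of i + 2 paths and an
    index p <= i, and (S, p) has degree the sum of the l_j for j in S. Give
    (S, p) the multidegree in which the first p + 1 elements of S carry an a
    and the others a b. The terms of the differential that preserve the
    multidegree form a complex for the initial ideal, on the same basis. In a
    fixed multidegree mu that complex depends only on which a_j and which b_j
    divide mu, and two successive cone contractions show that it is exact
    ([initial_exact]). The remaining terms of the Eagon-Northcott differential
    strictly lower the weight for which b_j has weight j and a_j weight 0, so
    exactness passes to the full complex by induction on the weight
    ([en_exact]).

    The nonzero entries of both differentials are signed monomials of positive
    degree, so the resolutions are minimal. By the comparison theorem
    ([tor_dim_indep]) the Betti numbers of either ideal therefore count the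
    pairs (S, p) of given degree: they equal i + 1 times the number of sets of
    i + 2 paths with given sum of the l_j. *)

(** * Comparison of graded free resolutions *)

Section HomogeneousMatrices.

Variables (K : fieldType) (n : nat).
Local Notation R := {mpoly K[n]}.

(** The matrices of degree-preserving maps between free modules whose basis
    vectors have the degrees [dr] and [ds]. *)
Definition homog_mx r s (dr : 'I_r -> nat) (ds : 'I_s -> nat) (M : 'M[R]_(r, s)) :=
  forall a b m, m \in msupp (M a b) -> (mdeg m + ds b)%N = dr a.

Definition shift_part (d e : nat) (p : R) : R :=
  if (e <= d)%N then pihomog mdeg (d - e) p else 0.

Lemma mcoeff_shift_part d e p m :
  (shift_part d e p)@_m = if (mdeg m + e)%N == d then p@_m else 0.
Proof.
rewrite /shift_part; case: leqP => [le_ed | lt_de]; last first.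
  by rewrite mcoeff0; case: eqP => //; lia.
have -> : ((mdeg m + e)%N == d) = (mdeg m == d - e)%N by apply/eqP/eqP; lia.
rewrite pihomogE raddf_sum /=.
under eq_bigr => m' _ do rewrite mcoeffZ mcoeffX.
case: (boolP (m \in msupp p)) => [m_p | m_np].
  rewrite -big_filter.
  case: ifP => deg_m; last first.
    rewrite big1_seq // => m' /= ; rewrite mem_filter => /andP[deg_m' _].
    by case: eqP => [em | _]; rewrite ?mulr0 //; rewrite -em deg_m' in deg_m.
  rewrite (bigD1_seq m) ?mem_filter ?deg_m ?filter_uniq //= eqxx mulr1.
  by rewrite big1 ?addr0 // => m' /negbTE->; rewrite mulr0.
rewrite (memN_msupp_eq0 m_np) if_same big1_seq // => m' /andP[_ m'_p].
by case: eqP m_np => [<- | _]; rewrite ?m'_p ?mulr0.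
Qed.

(** In every factorization of a monomial of the left-hand side the degree of the
    second factor is prescribed, hence so is that of the first. *)
Lemma shift_partM d e f (p q : R) :
  (forall m, m \in msupp q -> (mdeg m + f)%N = e) ->
  shift_part d f (p * q) = shift_part d e p * q.
Proof.
move=> hom_q; apply/mpolyP => m; rewrite mcoeff_shift_part !mcoeffM.
rewrite -[if _ then _ else _]/(if _ then _ else 0).
have -> (b : bool) (x : K) : (if b then x else 0) = x *+ b by case: b.
rewrite -sumrMnl; apply: eq_bigr => -[[m1 lt1] [m2 lt2]] /= /eqP Em.
have [/hom_q deg2|/memN_msupp_eq0->] := boolP (m2 \in msupp q); last first.
  by rewrite !mulr0 mul0rn.
rewrite mcoeff_shift_part Em mdegD -deg2 addnA.
by case: eqP => _; rewrite ?mul0r.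
Qed.

Definition homog_part r s (dr : 'I_r -> nat) (ds : 'I_s -> nat) (M : 'M[R]_(r, s)) :=
  \matrix_(a, b) shift_part (dr a) (ds b) (M a b).

Lemma homog_partP r s dr ds (M : 'M[R]_(r, s)) : homog_mx dr ds (homog_part dr ds M).
Proof.
move=> a b m; rewrite mxE mcoeff_msupp mcoeff_shift_part.
by case: ifP => [/eqP // | _]; rewrite eqxx.
Qed.

Lemma homog_part_id r s dr ds (M : 'M[R]_(r, s)) :
  homog_mx dr ds M -> homog_part dr ds M = M.
Proof.
move=> hom_M; apply/matrixP => a b; apply/mpolyP => m.
rewrite mxE mcoeff_shift_part; case: eqP => // ne_d.
by apply/esym/memN_msupp_eq0/negP => /hom_M.
Qed.

Lemma homog_part_mul r s t dr ds dt (M : 'M[R]_(r, s)) (N : 'M[R]_(s, t)) :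
  homog_mx ds dt N -> homog_part dr dt (M *m N) = homog_part dr ds M *m N.
Proof.
move=> hom_N; apply/matrixP => a c; rewrite !mxE.
have shift_sum I (l : seq I) (F : I -> R) d e :
    shift_part d e (\sum_(i <- l) F i) = \sum_(i <- l) shift_part d e (F i).
  rewrite /shift_part; case: ifP => _; last by rewrite big1.
  exact: raddf_sum.
rewrite shift_sum; apply: eq_bigr => b _; rewrite mxE.
by apply: shift_partM => m /hom_N.
Qed.

Lemma homog_mxM r s t dr ds dt (M : 'M[R]_(r, s)) (N : 'M[R]_(s, t)) :
  homog_mx dr ds M -> homog_mx ds dt N -> homog_mx dr dt (M *m N).
Proof.
move=> hom_M hom_N; rewrite -(homog_part_id hom_M) -(homog_part_mul dr M hom_N).
exact: homog_partP.
Qed.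

Lemma homog_mxB r s dr ds (M N : 'M[R]_(r, s)) :
  homog_mx dr ds M -> homog_mx dr ds N -> homog_mx dr ds (M - N).
Proof.
move=> hom_M hom_N a b m; rewrite !mxE => /msuppB_le.
by rewrite mem_cat => /orP[/hom_M | /hom_N].
Qed.

Lemma homog_mx1 r (dr : 'I_r -> nat) : homog_mx dr dr 1%:M.
Proof.
move=> a b m; rewrite mxE; case: eqP => [-> | _]; last by rewrite msupp0.
by rewrite msupp1 inE => /eqP->; rewrite mdeg0.
Qed.

(** The homogeneous part of any lift is again a lift, because [D] and [M] are
    homogeneous. *)
Lemma homog_lift r s t dr ds dt (D : 'M[R]_(s, t)) (M : 'M[R]_(r, t)) :
    homog_mx ds dt D -> homog_mx dr dt M ->
    (forall a, exists w, w *m D = row a M) ->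
  exists2 W, homog_mx dr ds W & W *m D = M.
Proof.
move=> hom_D hom_M lift; have [w wP] := fin_all_exists lift.
exists (homog_part dr ds (\matrix_a w a)); first exact: homog_partP.
rewrite -(homog_part_mul dr _ hom_D) -[RHS](homog_part_id hom_M); congr homog_part.
by apply/row_matrixP => a; rewrite row_mul rowK.
Qed.

(** Modulo the maximal ideal only the entries between basis vectors of the same
    degree survive. *)
Lemma homog_mx_const r s dr ds (M : 'M[R]_(r, s)) a b :
  homog_mx dr ds M -> (M a b)@_0%MM != 0 -> dr a = ds b.
Proof. by move=> hom_M; rewrite -mcoeff_msupp => /hom_M; rewrite mdeg0. Qed.

End HomogeneousMatrices.

Section AugmentedComplex.

Variables (K : fieldType) (n : nat) (I : {mpoly K[n]} -> Prop).
Local Notation R := {mpoly K[n]}.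
Implicit Types F G : graded_free_resolution I.

(** The ring itself is appended as term 0, so that the augmentation and the
    differentials can be treated alike. *)
Definition ext_rk F i := if i is i'.+1 then res_rk F i' else 1%N.

Definition ext_deg F i : 'I_(ext_rk F i) -> nat :=
  if i is i'.+1 return 'I_(ext_rk F i) -> nat then @res_deg _ _ _ F i' else fun=> 0%N.

Definition ext_dif F i : 'M[R]_(ext_rk F i.+1, ext_rk F i) :=
  if i is i'.+1 return 'M[R]_(ext_rk F i.+1, ext_rk F i) then res_dif F i'
  else res_aug F.

Lemma ext_dif_homog F i : homog_mx (@ext_deg F i.+1) (@ext_deg F i) (ext_dif F i).
Proof.
case: i => [|i] a b m /=; last exact: res_dif_homog.
by rewrite (ord1 b) addn0; apply: res_aug_homog.
Qed.

Lemma ext_exact F i (v : 'rV[R]_(ext_rk F i.+1)) :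
  v *m ext_dif F i = 0 <-> exists w, w *m ext_dif F i.+1 = v.
Proof. by case: i v => [|i] v; [apply: res_exact0 | apply: res_exactS]. Qed.

Lemma ext_dif_dif F i : ext_dif F i.+1 *m ext_dif F i = 0.
Proof.
apply/row_matrixP => a; rewrite row_mul row0.
apply: (proj2 (ext_exact (row a (ext_dif F i.+1)))).
by exists (delta_mx 0 a); rewrite rowE.
Qed.

Lemma ext_lift F i r (dr : 'I_r -> nat) (M : 'M[R]_(r, ext_rk F i.+1)) :
    homog_mx dr (@ext_deg F i.+1) M -> M *m ext_dif F i = 0 ->
  exists2 W, homog_mx dr (@ext_deg F i.+2) W & W *m ext_dif F i.+1 = M.
Proof.
move=> hom_M M0; apply: homog_lift (@ext_dif_homog F i.+1) hom_M _ => a.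
by apply: (proj1 (ext_exact (row a M))); rewrite -row_mul M0 row0.
Qed.

Lemma ext_lift0 F G :
  exists2 W, homog_mx (@ext_deg F 1) (@ext_deg G 1) W &
    W *m ext_dif G 0 = ext_dif F 0.
Proof.
apply: homog_lift (@ext_dif_homog G 0) (@ext_dif_homog F 0) _ => a.
have /(res_exact_aug G)[w wE] : I (res_aug F a ord0).
  by apply/(res_exact_aug F); exists (delta_mx 0 a); rewrite -rowE mxE.
by exists w; apply/matrixP => x y; rewrite (ord1 x) (ord1 y) wE mxE.
Qed.

(** The comparison theorem, truncated at step [i]: the chain maps and the
    homotopy are lifted through exactness, one step at a time. A single Tor
    module involves only consecutive steps, so no infinite family of maps has to
    be chosen. The clause on [s0] says that the homotopy starts with 0, over the
    identity of the ring. *)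
Lemma comparison F G i :
  exists f0 f1 g0 g1 (s0 : 'M[R]_(ext_rk F i, ext_rk F i.+1)) s1,
    [/\ homog_mx (@ext_deg F i) (@ext_deg G i) f0,
        homog_mx (@ext_deg F i.+1) (@ext_deg G i.+1) f1,
        homog_mx (@ext_deg G i) (@ext_deg F i) g0,
        homog_mx (@ext_deg G i.+1) (@ext_deg F i.+1) g1 &
        homog_mx (@ext_deg F i.+1) (@ext_deg F i.+2) s1] /\
    [/\ f1 *m ext_dif G i = ext_dif F i *m f0,
        g1 *m ext_dif F i = ext_dif G i *m g0,
        1%:M - f1 *m g1 = ext_dif F i *m s0 + s1 *m ext_dif F i.+1 &
        (i = 0%N -> s0 = 0)].
Proof.
elim: i => [|i [f0 [f1 [g0 [g1 [s0 [s1 [[hf0 hf1 hg0 hg1 hs1] [ef eg es _]]]]]]]]].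
  have [f1 hf1 ef] := ext_lift0 F G; have [g1 hg1 eg] := ext_lift0 G F.
  have hom_d : homog_mx (@ext_deg F 1) (@ext_deg F 1) (1%:M - f1 *m g1).
    by apply: homog_mxB (@homog_mx1 _ _ _ _) (homog_mxM hf1 hg1).
  have [|s1 hs1 es1] := ext_lift hom_d.
    by rewrite mulmxBl mul1mx -mulmxA eg ef subrr.
  exists 1%:M, f1, 1%:M, g1, 0, s1; rewrite !mulmx1 mulmx0 add0r es1.
  by do !split=> //; apply: homog_mx1.
have hom_fd : homog_mx (@ext_deg F i.+2) (@ext_deg G i.+1) (ext_dif F i.+1 *m f1).
  exact: homog_mxM (@ext_dif_homog F i.+1) hf1.
have hom_gd : homog_mx (@ext_deg G i.+2) (@ext_deg F i.+1) (ext_dif G i.+1 *m g1).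
  exact: homog_mxM (@ext_dif_homog G i.+1) hg1.
have [|f2 hf2 ef2] := ext_lift (F := G) hom_fd.
  by rewrite -mulmxA ef mulmxA ext_dif_dif mul0mx.
have [|g2 hg2 eg2] := ext_lift hom_gd.
  by rewrite -mulmxA eg mulmxA ext_dif_dif mul0mx.
have hom_s : homog_mx (@ext_deg F i.+2) (@ext_deg F i.+2)
    (1%:M - f2 *m g2 - ext_dif F i.+1 *m s1).
  apply: homog_mxB; last exact: homog_mxM (@ext_dif_homog F i.+1) hs1.
  by apply: homog_mxB (@homog_mx1 _ _ _ _) (homog_mxM hf2 hg2).
have [|s2 hs2 es2] := ext_lift hom_s.
  rewrite !mulmxBl mul1mx -mulmxA eg2 mulmxA ef2 -!mulmxA.
  rewrite -{1}[ext_dif F i.+1]mulmx1 -!mulmxBr.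
  have -> : 1%:M - f1 *m g1 - s1 *m ext_dif F i.+1 = ext_dif F i *m s0.
    by rewrite es addrK.
  by rewrite mulmxA ext_dif_dif mul0mx.
exists f1, f2, g1, g2, s1, s2; do !split=> //.
by rewrite es2 [RHS]addrC subrK.
Qed.

End AugmentedComplex.

Section TorIndependence.

Variables (K : fieldType).

(** The matrix [Z *m f *m cokermx B'] represents the image of [Z] in the
    quotient of [Z'] by [B'], and the part of [Z] that it kills lies in [B]. *)
Lemma rank_quotient_le r s mz mb mz' mb' (Z : 'M[K]_(mz, r)) (B : 'M[K]_(mb, r))
    (Z' : 'M[K]_(mz', s)) (B' : 'M[K]_(mb', s)) (f : 'M[K]_(r, s)) :
    (B <= Z)%MS -> (B' <= Z')%MS -> (Z *m f <= Z')%MS ->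
    (forall v : 'rV_r, (v <= Z)%MS -> (v *m f <= B')%MS -> (v <= B)%MS) ->
  (\rank Z - \rank B <= \rank Z' - \rank B')%N.
Proof.
move=> BZ BZ' ZfZ' inj_f.
have kerB : (Z :&: kermx (f *m cokermx B') <= B)%MS.
  apply/row_subP => i; apply: inj_f.
    by apply: submx_trans (row_sub _ _) (capmxSl _ _).
  rewrite submxE -mulmxA; apply/eqP/sub_kermxP.
  by apply: submx_trans (row_sub _ _) (capmxSr _ _).
have rk1 := mxrank_mul_ker Z (f *m cokermx B').
have rk2 := mxrank_mul_ker Z' (cokermx B').
have -> : (\rank Z' - \rank B')%N = \rank (Z' *m cokermx B').
  have eqB : (Z' :&: kermx (cokermx B') :=: B')%MS.
    apply/eqmxP/andP; split; last first.
      by rewrite sub_capmx BZ'; apply/sub_kermxP; rewrite mulmx_coker.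
    by rewrite submxE -sub_kermx capmxSr.
  by rewrite -rk2 eqB addnK.
apply: leq_trans (_ : \rank (Z *m (f *m cokermx B')) <= _)%N.
  by rewrite -rk1; have := mxrankS kerB; lia.
by rewrite mulmxA; apply/mxrankS/submxMr.
Qed.


Variable n : nat.
Local Notation R := {mpoly K[n]}.
Local Notation at0 := (map_mx (mcoeff (0%MM : 'X_{1..n}))).

Definition degree_part r (d : 'I_r -> nat) j : 'M[K]_r :=
  diag_mx (\row_a (d a == j)%:R).

Lemma degree_part_at0 r s dr ds (M : 'M[R]_(r, s)) j : homog_mx dr ds M ->
  degree_part dr j *m at0 M = at0 M *m degree_part ds j.
Proof.
move=> hom_M; rewrite /degree_part mul_diag_mx mul_mx_diag.
apply/matrixP => a b; rewrite !mxE mulrC.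
have [->|nz] := eqVneq (M a b)@_0%MM 0; first by rewrite !mul0r.
by rewrite (homog_mx_const hom_M nz).
Qed.

Variable I : R -> Prop.
Implicit Types F G : graded_free_resolution I.

Lemma tensor_dif_comm F i j :
  tensor_part F i.+1 j *m tensor_dif F i = tensor_dif F i *m tensor_part F i j.
Proof. exact: (degree_part_at0 j (@ext_dif_homog _ _ _ F i.+1)). Qed.

Lemma tensor_dif_dif F i : tensor_dif F i.+1 *m tensor_dif F i = 0.
Proof.
rewrite /tensor_dif -map_mxM.
by rewrite [X in map_mx _ X](@ext_dif_dif _ _ _ F i.+1) map_mx0.
Qed.

Lemma sub_tensor_cycles F i j m (v : 'M_(m, res_rk F i)) :
  (v <= tensor_cycles F i j)%MS =
    (v <= tensor_part F i j)%MS && ((i == 0)%N || (v *m at0 (ext_dif F i) == 0)).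
Proof. by case: i v => [|i] v /=; rewrite ?andbT // sub_capmx sub_kermx. Qed.

Lemma tensor_boundaries_cycles F i j :
  (tensor_boundaries F i j <= tensor_cycles F i j)%MS.
Proof.
rewrite sub_tensor_cycles /tensor_boundaries tensor_dif_comm submxMl /=.
case: i => [|i] //=; apply/eqP.
by rewrite -tensor_dif_comm -mulmxA [X in _ *m X]tensor_dif_dif mulmx0.
Qed.

(** The homotopy makes the composite of the two comparison maps the identity on
    cycles modulo boundaries, so the first of them is injective on homology. *)
Lemma tor_dim_le F G i j : (tor_dim F i j <= tor_dim G i j)%N.
Proof.
have [f0 [f1 [g0 [g1 [s0 [s1 [[hf0 hf1 hg0 hg1 hs1] [ef eg es s00]]]]]]]] :=
  comparison F G i.
have hom_gd : homog_mx (@ext_deg _ _ _ G i.+2) (@ext_deg _ _ _ F i.+1) (ext_dif G i.+1 *m g1).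
  exact: homog_mxM (@ext_dif_homog _ _ _ G i.+1) hg1.
have [|g2 hg2 eg2] := ext_lift hom_gd.
  by rewrite -mulmxA eg mulmxA ext_dif_dif mul0mx.
apply: (@rank_quotient_le _ _ _ _ _ _ _ _ _ _ (at0 f1)); do ?exact: tensor_boundaries_cycles.
  have := submx_refl (tensor_cycles F i j).
  rewrite !sub_tensor_cycles => /andP[/submxP[u ->] Z0]; apply/andP; split.
    by rewrite -mulmxA (degree_part_at0 j hf1) mulmxA submxMl.
  case: eqP Z0 => //= _ /eqP Z0; apply/eqP.
  by rewrite -(mulmxA _ (at0 f1)) -map_mxM ef map_mxM mulmxA Z0 mul0mx.
move=> v; rewrite sub_tensor_cycles => /andP[vPart vZ] vfB.
have vE : v = v *m (at0 f1 *m at0 g1) + v *m (1%:M - at0 f1 *m at0 g1).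
  by rewrite mulmxBr mulmx1 addrC subrK.
have /submxP[w vfE] := vfB; have /submxP[u uE] := vPart.
have comm1 := degree_part_at0 j hg2; have comm2 := degree_part_at0 j hs1.
have -> : tensor_boundaries F i j =
    degree_part (@ext_deg _ _ _ F i.+2) j *m at0 (ext_dif F i.+1) by [].
rewrite vE addmx_sub //.
  rewrite mulmxA vfE -!mulmxA -map_mxM -[res_dif G i]/(ext_dif G i.+1) -eg2.
  rewrite map_mxM [_ *m (at0 g2 *m _)]mulmxA comm1.
  by rewrite -(mulmxA (at0 g2)) (mulmxA w) submxMl.
suff -> : v *m (1%:M - at0 f1 *m at0 g1) = v *m at0 s1 *m tensor_dif F i.
  by rewrite uE -(mulmxA u) [X in u *m X]comm2 mulmxA -mulmxA submxMl.
have <- : at0 (1%:M : 'M[R]_(ext_rk F i.+1)) = 1%:M by rewrite map_mx1.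
rewrite -map_mxM -map_mxB es map_mxD !map_mxM mulmxDr.
rewrite -[LHS]addrC [in RHS]/tensor_dif mulmxA -[RHS]addr0; congr (_ + _).
rewrite mulmxA; case: eqP vZ => [/s00-> _ | _ /= /eqP->]; last by rewrite mul0mx.
by rewrite map_mx0 mulmx0.
Qed.

Lemma tor_dim_indep F G i j : tor_dim F i j = tor_dim G i j.
Proof. by apply/eqP; rewrite eqn_leq !tor_dim_le. Qed.

(** The number [betti I i j] is computed from an unspecified resolution; by
    independence any resolution yields it. *)
Lemma betti_resolution F i j : betti I i j = tor_dim F i j.
Proof.
have ex_b : exists b, exists F : graded_free_resolution I, tor_dim F i j = b.
  by exists (tor_dim F i j), F.
rewrite /betti; have [G <-] := epsilon_spec (inhabits 0%N) _ ex_b.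
exact: tor_dim_indep.
Qed.

End TorIndependence.

(** * The Eagon-Northcott complex and its initial complex *)

Section SubsetRank.

Variable h : nat.
Implicit Types (j k : 'I_h) (S T : {set 'I_h}).

(** The position of [j] in [S], counted from 0 when [j] belongs to [S]; it gives
    the Koszul sign of adding or removing [j]. *)
Definition idx j S : nat := #|[set k in S | (k < j)%N]|.

Lemma idx_set0 j : idx j set0 = 0%N.
Proof. by apply/eqP; rewrite cards_eq0; apply/eqP/setP => x; rewrite !inE. Qed.

Lemma idxU1 j k T : j \notin T -> idx k (j |: T) = ((j < k) + idx k T)%N.
Proof.
move=> jT; rewrite /idx; have [lt_jk|le_kj] := ltnP j k.
  rewrite -[RHS](_ : #|j |: [set x in T | x < k]| = _)%N.
    congr #|pred_of_set _|; apply/setP => x; rewrite !inE.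
    by case: eqP => [->|_] //=; rewrite lt_jk.
  by rewrite cardsU1 inE (negbTE jT).
rewrite add0n; congr #|pred_of_set _|; apply/setP => x; rewrite !inE.
by case: eqP => [->|_] //=; rewrite ltnNge le_kj andbF.
Qed.

Lemma idx_leq j k T : (j <= k)%N -> (idx j T <= idx k T)%N.
Proof.
move=> le_jk; apply/subset_leq_card/subsetP => x; rewrite !inE.
by case/andP=> -> /leq_trans->.
Qed.

Lemma idx_ltn j k T : k \in T -> (k < j)%N -> (idx k T < idx j T)%N.
Proof.
move=> kT lt_kj; apply/proper_card/properP; split.
  apply/subsetP => x; rewrite !inE => /andP[-> /= lt_xk].
  exact: ltn_trans lt_xk lt_kj.
by exists k; rewrite !inE ?kT //= ltnn.
Qed.

Lemma idx_ltn_card j T : j \in T -> (idx j T < #|T|)%N.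
Proof.
move=> jT; apply/proper_card/properP; split.
  by apply/subsetP => x; rewrite !inE => /andP[].
by exists j; rewrite ?inE ?jT //= ltnn.
Qed.

Lemma idx_inj T : {in T &, injective (fun j => idx j T)}.
Proof.
move=> j k jT kT eq_i; apply: val_inj => /=.
have := @idx_ltn j k T kT; have := @idx_ltn k j T jT; lia.
Qed.

Lemma idx_surj q T : (q < #|T|)%N -> exists2 k, k \in T & idx k T = q.
Proof.
move=> lt_q; have lt_i (i : 'I_#|T|) : (idx (enum_val i) T < #|T|)%N.
  exact: idx_ltn_card (enum_valP i).
have inj_f : injective (fun i => Ordinal (lt_i i)).
  move=> i i' [] /idx_inj eq_i; apply: enum_val_inj.
  by apply: eq_i; apply: enum_valP.
have [g _ fK] := injF_bij inj_f; have := fK (Ordinal lt_q).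
by case=> <-; exists (enum_val (g (Ordinal lt_q))) => //; apply: enum_valP.
Qed.

End SubsetRank.

Section EagonNorthcott.

Variables (R : comNzRingType) (h : nat).
Implicit Types (j k : 'I_h) (S T : {set 'I_h}).

(** The terms at (j, k) and (k, j) cancel, in every characteristic. *)
Lemma antisym_sum (P : pred 'I_h) (G : 'I_h -> 'I_h -> R) :
    (forall j k, P j -> P k -> (j < k)%N -> G j k = - G k j) ->
  \sum_(j | P j) \sum_(k | (k != j) && P k) G j k = 0.
Proof.
move=> anti; pose H j k : R := if [&& P j, P k & (j < k)%N] then G j k else 0.
transitivity (\sum_j \sum_k (H j k - H k j)).
  rewrite big_mkcond; apply: eq_bigr => j _.
  case: ifP => Pj; last by rewrite big1 // => k _; rewrite /H Pj andbF subrr.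
  rewrite big_mkcond; apply: eq_bigr => k _; rewrite /H Pj /=.
  case: (boolP (P k)) => Pk /=; rewrite ?andbF ?subrr // andbT -val_eqE /=.
  case: ltngtP => //=; rewrite ?subr0 ?subrr // => lt_kj.
  by rewrite sub0r (anti k j) ?opprK.
under eq_bigr => j _ do rewrite sumrB.
by rewrite sumrB [X in _ - X]exchange_big subrr.
Qed.

Variables (eps : bool) (a b : 'I_h -> R).
Implicit Type v : {set 'I_h} -> nat -> R.

Definition takes_a j T q := eps || (idx j T <= q.+1)%N.
Definition takes_b j T q := eps || (q.+1 <= idx j T)%N.

(** A family [v S p] holds the coordinates of an element of the Eagon-Northcott
    complex of the matrix with rows [a] and [b]: for [#|S| = i + 2] the pair (S,
    p) stands for the exterior product of S times the divided power monomial of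
    bidegree (p, i - p). The differential removes an element of S with
    coefficient a, lowering p, or with coefficient b, keeping p; in coordinates
    its value at (T, q) is a sum over the elements that can be added to T. With
    [eps = false] an element is removed with coefficient a only if it is among
    the first p + 1 of S, and with coefficient b only if it is not. *)
Definition en_dif v T q : R :=
  \sum_(j | j \notin T) (-1) ^+ idx j T *
    ((takes_a j T q)%:R * a j * v (j |: T) q.+1 +
     (takes_b j T q)%:R * b j * v (j |: T) q).

(** The sum runs over ordered pairs, so that the composite with the differential
    is visibly antisymmetric; [en_augE] collects the two orders into a minor. *)
Definition en_aug v : R :=
  \sum_(j < h) \sum_(k < h | (k != j) && (eps || (j < k)%N))
    (-1) ^+ (k < j)%N * (a j * b k * v [set j; k] 0%N).

(** The two orders in which a pair of elements can be added come with opposite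
    signs and equal coefficients. With [eps = false] this also requires that the
    conditions on positions agree for the two orders. *)
Lemma en_dif_dif v T q : en_dif (en_dif v) T q = 0.
Proof.
pose G j k : R := (-1) ^+ idx j T * (-1) ^+ idx k (j |: T) *
  ((takes_a j T q && takes_a k (j |: T) q.+1)%:R * (a j * a k * v (k |: (j |: T)) q.+2) +
   ((takes_a j T q && takes_b k (j |: T) q.+1)%:R * (a j * b k) +
    (takes_b j T q && takes_a k (j |: T) q)%:R * (b j * a k)) * v (k |: (j |: T)) q.+1 +
   (takes_b j T q && takes_b k (j |: T) q)%:R * (b j * b k * v (k |: (j |: T)) q)).
transitivity (\sum_(j | j \notin T) \sum_(k | (k != j) && (k \notin T)) G j k).
  apply: eq_bigr => j jT; rewrite /en_dif !mulr_sumr -big_split mulr_sumr /=.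
  apply: eq_big => [k|k _]; first by rewrite !inE negb_or.
  by rewrite /G -!mulnb !natrM; ring.
apply: antisym_sum => j k jT kT lt_jk; rewrite /G /takes_a /takes_b.
rewrite [k |: (j |: T)]setUCA !idxU1 // lt_jk.
have -> : (k < j)%N = false by lia.
have := idx_leq T (ltnW lt_jk); move: (idx j T) (idx k T) => x y le_xy.
have -> : (eps || (x <= q.+1)%N) && (eps || (1 + y <= q.+2)%N) =
          (eps || (y <= q.+1)%N) && (eps || (0 + x <= q.+2)%N).
  by case: eps => //=; lia.
have -> : (eps || (x <= q.+1)%N) && (eps || (q.+2 <= 1 + y)%N) =
          (eps || (q.+1 <= y)%N) && (eps || (0 + x <= q.+1)%N).
  by case: eps => //=; lia.
have -> : (eps || (q.+1 <= x)%N) && (eps || (1 + y <= q.+1)%N) =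
          (eps || (y <= q.+1)%N) && (eps || (q.+2 <= 0 + x)%N).
  by case: eps => //=; lia.
have -> : (eps || (q.+1 <= x)%N) && (eps || (q.+1 <= 1 + y)%N) =
          (eps || (q.+1 <= y)%N) && (eps || (q.+1 <= 0 + x)%N).
  by case: eps => //=; lia.
rewrite add0n add1n exprS; ring.
Qed.

(** The part with two factors a is antisymmetric in the indices of these
    factors, and likewise for b. *)
Lemma en_aug_dif v : en_aug (en_dif v) = 0.
Proof.
pose c j k := eps || (j < k)%N.
pose Ga k j i : R := (c j k && takes_a i [set j; k] 0)%:R *
  ((-1) ^+ (k < j)%N * (-1) ^+ idx i [set j; k] *
   (a j * a i * b k * v (i |: [set j; k]) 1%N)).
pose Gb j k i : R := (c j k && takes_b i [set j; k] 0)%:R *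
  ((-1) ^+ (k < j)%N * (-1) ^+ idx i [set j; k] *
   (a j * b k * b i * v (i |: [set j; k]) 0%N)).
transitivity (
  \sum_(k < h) \sum_(j < h | j != k) \sum_(i < h | (i != j) && (i != k)) Ga k j i +
  \sum_(j < h) \sum_(k < h | k != j) \sum_(i < h | (i != k) && (i != j)) Gb j k i).
  rewrite (exchange_big_dep predT) //= -big_split; apply: eq_bigr => j _ /=.
  rewrite big_mkcondr [X in _ = X + _](eq_bigl (fun k => k != j)); last first.
    by move=> k; rewrite eq_sym.
  rewrite -big_split; apply: eq_bigr => k kj /=.
  have -> (x : R) : (if c j k then x else 0) = (c j k)%:R * x.
    by case: (c j k); rewrite ?mul1r ?mul0r.
  rewrite [X in _ = _ + X](eq_bigl (fun i => (i != j) && (i != k))); last first.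
    by move=> i; rewrite andbC.
  rewrite -big_split /en_dif !mulr_sumr; apply: eq_big => [i|i _].
    by rewrite !inE negb_or.
  by rewrite /Ga /Gb /= -!mulnb !natrM; ring.
have idx2 j k i : j != k -> idx i [set j; k] = ((j < i) + (k < i))%N.
  move=> jk; rewrite idxU1 ?inE // -[[set k]]setU0 idxU1 ?inE //.
  by rewrite idx_set0 addn0.
rewrite !big1 ?addr0 // => [j _|k _].
  apply: (antisym_sum (P := fun k => k != j)) => k i kj ij lt_ki.
  have [jk ji] : j != k /\ j != i by rewrite ![j == _]eq_sym.
  rewrite /Gb /c /takes_b !idx2 // lt_ki.
  have -> : i |: [set j; k] = k |: [set j; i].
    by apply/setP => x; rewrite !inE; do 3 case: (x == _).
  have -> : (i < k)%N = false by lia.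
  have neq_kj : k <> j :> nat by apply/eqP.
  have neq_ij : i <> j :> nat by apply/eqP.
  case: eps; case: (ltngtP k j) => h1; case: (ltngtP i j) => h2 /=; try (exfalso; lia); ring.
apply: (antisym_sum (P := fun j => j != k)) => j i jk ik lt_ji.
rewrite /Ga /c /takes_a !idx2 // lt_ji.
have -> : i |: [set j; k] = j |: [set i; k].
  by apply/setP => x; rewrite !inE; do 3 case: (x == _).
have -> : (i < j)%N = false by lia.
have neq_jk : j <> k :> nat by apply/eqP.
have neq_ik : i <> k :> nat by apply/eqP.
case: eps; case: (ltngtP j k) => h1; case: (ltngtP i k) => h2 /=; try (exfalso; lia); ring.
Qed.

Definition en_index i S p := (#|S| == i.+2) && (p <= i)%N.

Lemma en_indexU1 i j T q : j \notin T -> en_index i T q ->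
  en_index i.+1 (j |: T) q /\ en_index i.+1 (j |: T) q.+1.
Proof. by move=> jT /andP[/eqP sT le_q]; rewrite /en_index cardsU1 jT sT; lia. Qed.

Lemma eq_en_dif i v w T q : (forall S p, en_index i.+1 S p -> v S p = w S p) ->
  en_index i T q -> en_dif v T q = en_dif w T q.
Proof.
move=> eq_vw Tq; apply: eq_bigr => j jT.
by have [? ?] := en_indexU1 jT Tq; rewrite !eq_vw.
Qed.

Lemma eq_en_aug v w : (forall S p, en_index 0 S p -> v S p = w S p) ->
  en_aug v = en_aug w.
Proof.
move=> eq_vw; apply: eq_bigr => j _; apply: eq_bigr => k /andP[kj _].
by rewrite eq_vw // /en_index cards2 [j == _]eq_sym kj.
Qed.

Lemma en_dif_linear x v w T q :
  en_dif (fun S p => x * v S p + w S p) T q = x * en_dif v T q + en_dif w T q.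
Proof.
by rewrite /en_dif mulr_sumr -big_split; apply: eq_bigr => j _ /=; ring.
Qed.

Lemma en_aug_linear x v w :
  en_aug (fun S p => x * v S p + w S p) = x * en_aug v + en_aug w.
Proof.
rewrite /en_aug mulr_sumr -big_split; apply: eq_bigr => j _ /=.
rewrite mulr_sumr -big_split; apply: eq_bigr => k _ /=; ring.
Qed.

Definition en_cycle i v :=
  if i is i'.+1 then forall T q, en_index i' T q -> en_dif v T q = 0
  else en_aug v = 0.

Lemma eq_en_cycle i v w : (forall S p, en_index i S p -> v S p = w S p) ->
  en_cycle i v -> en_cycle i w.
Proof.
case: i => [|i] eq_vw /= cyc_v; first by rewrite -(eq_en_aug eq_vw).
by move=> T q Tq; rewrite -(eq_en_dif eq_vw Tq) cyc_v.
Qed.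

Lemma en_cycle_dif i v : en_cycle i (en_dif v).
Proof. by case: i => [|i] /=; [apply: en_aug_dif | move=> T q _; apply: en_dif_dif]. Qed.

Lemma en_cycleB_dif i v w : en_cycle i v ->
  en_cycle i (fun S p => v S p - en_dif w S p).
Proof.
have eq_v S p : -1 * en_dif w S p + v S p = v S p - en_dif w S p by ring.
move=> cyc_v; apply: (eq_en_cycle (fun S p _ => eq_v S p)); case: i cyc_v => [|i] /= cyc_v.
  by rewrite en_aug_linear en_aug_dif mulr0 add0r.
by move=> T q Tq; rewrite en_dif_linear en_dif_dif mulr0 add0r cyc_v.
Qed.

Lemma en_augE v :
  en_aug v = \sum_(j < h) \sum_(k < h | (j < k)%N)
    (a j * b k - eps%:R * (a k * b j)) * v [set j; k] 0%N.
Proof.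
transitivity (\sum_(j < h) \sum_(k < h | (j < k)%N) a j * b k * v [set j; k] 0%N -
    \sum_(j < h) \sum_(k < h | (j < k)%N) eps%:R * (a k * b j) * v [set j; k] 0%N); last first.
  rewrite -sumrB; apply: eq_bigr => j _; rewrite -sumrB.
  by apply: eq_bigr => k _; rewrite mulrBl.
rewrite [X in _ = _ - X](exchange_big_dep predT) //= -sumrB; apply: eq_bigr => j _.
rewrite (bigID (fun k : 'I_h => (j < k)%N)) /= -sumrN; congr (_ + _).
  apply: eq_big => [k|k /andP[_ lt_jk]]; first by rewrite -val_eqE /=; case: eps => /=; lia.
  by rewrite ltnNge (ltnW lt_jk) /= mul1r.
rewrite big_mkcond [RHS]big_mkcond; apply: eq_bigr => k _; rewrite -val_eqE /=.
case: ltngtP => //= lt; rewrite ?andbF //= ?orbF ?andbT.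
by case: eps => /=; rewrite ?mul0r ?oppr0 // setUC mul1r mulN1r.
Qed.

End EagonNorthcott.

(** * Exactness of the initial complex in one multidegree *)

Section InitialStrand.

Variables (R : comNzRingType) (h : nat) (U V : {set 'I_h}).
Implicit Types (j k : 'I_h) (S T : {set 'I_h}) (c : {set 'I_h} -> nat -> R).

(** If [j] is placed in the initial segment, then the old initial segment,
    together with [j], is the new one. *)
Lemma idx_letter_a j k T q : j \notin T -> k \in T -> (idx j T <= q.+1)%N ->
  (idx k (j |: T) <= q.+1)%N = (idx k T <= q)%N.
Proof.
move=> jT kT le_q; rewrite idxU1 //; have [lt_jk|le_kj] /= := ltnP j k; first by lia.
have := @idx_ltn _ j k T kT; have : k != j by apply: contraNneq jT => <-.
rewrite -val_eqE /=; lia.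
Qed.

Lemma idx_letter_b j k T q : j \notin T -> k \in T -> (q.+1 <= idx j T)%N ->
  (idx k (j |: T) <= q)%N = (idx k T <= q)%N.
Proof.
move=> jT kT le_q; rewrite idxU1 //; have [lt_jk|le_kj] //= := ltnP j k.
have := idx_leq T (ltnW lt_jk); lia.
Qed.

Lemma idxU1_self j T : j \notin T -> idx j (j |: T) = idx j T.
Proof. by move=> jT; rewrite idxU1 // ltnn. Qed.

(** The basis vectors that occur in a fixed multidegree mu, when [U] and [V] are
    the sets of the indices k for which a_k, respectively b_k, divides mu. *)
Definition allowed S p := [forall (k | k \in S), k \in if (idx k S <= p)%N then U else V].

Lemma allowedU1_a j T q : j \notin T -> (idx j T <= q.+1)%N ->
  allowed (j |: T) q.+1 = (j \in U) && allowed T q.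
Proof.
move=> jT le_q; apply/forall_inP/andP => [all_jT | [jU /forall_inP all_T] k].
  split; first by have := all_jT j; rewrite setU11 idxU1_self // le_q; apply.
  apply/forall_inP => k kT; have := all_jT k; rewrite idx_letter_a //.
  by apply; rewrite setU1r.
case/setU1P=> [->|kT]; first by rewrite idxU1_self // le_q.
by rewrite idx_letter_a //; apply: all_T.
Qed.

Lemma allowedU1_b j T q : j \notin T -> (q.+1 <= idx j T)%N ->
  allowed (j |: T) q = (j \in V) && allowed T q.
Proof.
move=> jT le_q; apply/forall_inP/andP => [all_jT | [jU /forall_inP all_T] k].
  split; first by have := all_jT j; rewrite setU11 idxU1_self // leqNgt le_q; apply.
  apply/forall_inP => k kT; have := all_jT k; rewrite idx_letter_b //.
  by apply; rewrite setU1r.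
case/setU1P=> [->|kT]; first by rewrite idxU1_self // leqNgt le_q.
by rewrite idx_letter_b //; apply: all_T.
Qed.

Definition strand i c := forall S p, c S p != 0 -> en_index i S p && allowed S p.

Local Notation dif := (@en_dif R h false (fun=> 1) (fun=> 1)).
Local Notation cycle := (@en_cycle R h false (fun=> 1) (fun=> 1)).

(** The values of [en_dif] at pairs that do not index the basis are meaningless. *)
Definition trunc i c S p : R := if en_index i S p then c S p else 0.

Lemma strand_trunc_dif i c : strand i.+1 c -> strand i (trunc i (dif c)).
Proof.
move=> str_c T q; rewrite /trunc; case: ifP => [Tq|_]; last by rewrite eqxx.
apply: contraR => /= nall_T; rewrite /en_dif big1 // => j jT.
rewrite /takes_a /takes_b !mulr1.
have [le_a|_] := leqP (idx j T) q.+1; have [le_b|_] := leqP q.+1 (idx j T);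
  rewrite ?mul1r ?mul0r ?add0r ?addr0 ?mulr0 //.
- have [/str_c|/negPn/eqP->] := boolP (c (j |: T) q.+1 != 0).
    by rewrite allowedU1_a // (negbTE nall_T) !andbF.
  have [/str_c|/negPn/eqP->] := boolP (c (j |: T) q != 0); last by rewrite addr0 mulr0.
  by rewrite allowedU1_b // (negbTE nall_T) !andbF.
- have [/str_c|/negPn/eqP->] := boolP (c (j |: T) q.+1 != 0); last by rewrite mulr0.
  by rewrite allowedU1_a // (negbTE nall_T) !andbF.
- have [/str_c|/negPn/eqP->] := boolP (c (j |: T) q != 0); last by rewrite mulr0.
  by rewrite allowedU1_b // (negbTE nall_T) !andbF.
Qed.

Lemma strandB i c c' : strand i c -> strand i c' -> strand i (fun S p => c S p - c' S p).
Proof.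
move=> str_c str_c' S p; have [/str_c //|/negPn/eqP->] := boolP (c S p != 0).
by rewrite sub0r oppr_eq0 => /str_c'.
Qed.

Lemma strand_sub_dif i c u : strand i c -> strand i.+1 u ->
  strand i (fun S p => c S p - trunc i (dif u) S p).
Proof. by move=> ? ?; apply: strandB => //; apply: strand_trunc_dif. Qed.

Lemma cycle_sub_dif i c u : cycle i c -> cycle i (fun S p => c S p - trunc i (dif u) S p).
Proof.
move=> cyc_c; apply: eq_en_cycle (en_cycleB_dif u cyc_c) => S p Sp.
by rewrite /trunc Sp.
Qed.

(** Used when [c] is supported on sets containing [x], with [T] one that omits it. *)
Lemma dif_pivot x c T q : x \notin T ->
    (forall j p, j \notin T -> j != x -> c (j |: T) p = 0) ->
  dif c T q = (-1) ^+ idx x T * ((idx x T <= q.+1)%:R * c (x |: T) q.+1 +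
                                 (q.+1 <= idx x T)%:R * c (x |: T) q).
Proof.
move=> xT c0; rewrite /en_dif (bigD1 x) //= !mulr1 big1 ?addr0 // => j /andP[jT jx].
by rewrite !c0 // !mulr0 addr0 mulr0.
Qed.

Section PivotA.

Variables (j0 : 'I_h).
Hypotheses (j0U : j0 \in U) (j0_min : forall k, k \in U -> (j0 <= k)%N).

(** The first element of [T] lies in [U]. *)
Lemma allowed_idx_min i T q : en_index i T q -> allowed T q -> idx j0 T = 0%N.
Proof.
move=> /andP[/eqP sT _] /forall_inP all_T.
have [|k kT k0] := @idx_surj h 0 T; first by rewrite sT.
have := all_T k kT; rewrite k0 /= => /j0_min le_jk.
by apply/eqP; rewrite -leqn0 -k0 idx_leq.
Qed.

(** Adding the least element j0 of [U] while raising p contracts the strand onto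
    the part with p = 0 and j0 in S. On that part j0 is the only element that
    carries an a, and it cannot be removed. *)
Lemma pivot_a i c : strand i c -> cycle i c ->
  exists2 u, strand i.+1 u &
    forall S p, c S p - trunc i (dif u) S p != 0 -> (p == 0)%N && (j0 \in S).
Proof.
move=> str_c cyc_c.
pose u S p := if (j0 \in S) && (0 < p)%N then c (S :\ j0) p.-1 else 0.
have str_u : strand i.+1 u.
  move=> S p; rewrite /u; case: ifP => [/andP[j0S p_gt0]|]; last by rewrite eqxx.
  case/str_c/andP => Sp all_S; have := allowed_idx_min Sp all_S => idx0.
  have j0T : j0 \notin S :\ j0 by rewrite setD11.
  have [_] := en_indexU1 j0T Sp; rewrite setD1K // prednK // => ->.
  have := allowedU1_a (q := p.-1) j0T; rewrite idx0 setD1K // prednK // => -> //.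
  by rewrite j0U.
exists u => // S p.
set c1 := fun S p => c S p - trunc i (dif u) S p.
have str1 : strand i c1 by exact: strand_sub_dif.
have cyc1 : cycle i c1 by exact: cycle_sub_dif.
have c1_out T q : j0 \notin T -> c1 T q = 0.
  move=> j0T; rewrite /c1 /trunc; case: ifP => Tq; last first.
    have [/str_c|/negPn/eqP->] := boolP (c T q != 0); rewrite ?Tq ?subr0 //.
  rewrite (dif_pivot _ j0T) => [|j p' _ jj0]; last first.
    by rewrite /u !inE eq_sym (negbTE jj0) (negbTE j0T).
  rewrite /u !setU11 setU1K //=.
  have [->|idx_pos] := posnP (idx j0 T).
    by rewrite /= mul1r mul0r addr0 mul1r subrr.
  have c0 q' : c T q' = 0.
    apply/eqP/negPn/negP => /str_c/andP[Tq' /(allowed_idx_min Tq')]; lia.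
  by rewrite !c0 if_same !mulr0 addr0 mulr0 subrr.
move=> c1_nz; have /andP[Sp all_S] := str1 S p c1_nz.
have j0S : j0 \in S by apply: contraR c1_nz => j0S; exact/eqP/c1_out.
rewrite j0S andbT -leqn0 leqNgt; apply: contra c1_nz => p_gt0.
have j0T : j0 \notin S :\ j0 by rewrite setD11.
have idx0 : idx j0 (S :\ j0) = 0%N.
  by rewrite -idxU1_self // setD1K // (allowed_idx_min Sp).
case: i @c1 c1_out str_c cyc_c str_u str1 cyc1 Sp
  => [|i] c1 c1_out _ _ _ _ cyc1 /andP[/eqP sS le_p].
  by lia.
have := cyc1 (S :\ j0) p.-1; rewrite /en_index.
have -> : #|S :\ j0| = i.+2 by have := cardsD1 j0 S; rewrite j0S sS add1n => -[<-].
have -> /= : (p.-1 <= i)%N by lia.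
rewrite eqxx => /(_ isT).
rewrite (dif_pivot _ j0T) => [|j p' _ jj0]; last first.
  by rewrite c1_out // !inE eq_sym (negbTE jj0) eqxx.
by rewrite setD1K // idx0 /= mul0r addr0 !mul1r prednK // => /eqP.
Qed.

End PivotA.

Section PivotB.

Variables (j0 k0 : 'I_h).
Hypotheses (j0U : j0 \in U) (j0_min : forall k, k \in U -> (j0 <= k)%N).
Hypotheses (k0V : k0 \in V) (k0_max : forall k, k \in V -> (k <= k0)%N).

Lemma allowed_le_max i T k : en_index i T 0 -> allowed T 0 -> k \in T -> (k <= k0)%N.
Proof.
move=> /andP[/eqP sT _] /forall_inP all_T kT.
have := all_T k kT; case: ifP => [|_ /k0_max //]; rewrite leqn0 => /eqP idxk _.
have [|k' k'T idx1] := @idx_surj h 1 T; first by rewrite sT.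
have := all_T k' k'T; rewrite idx1 /= => /k0_max; apply: leq_trans.
by rewrite leqNgt; apply/negP => /ltnW /(idx_leq T); lia.
Qed.

Lemma setD1_notin k T : k \notin T -> T :\ k = T.
Proof. by move=> kT; apply/setDidPl; rewrite disjoint_sym disjoints1. Qed.

Lemma allowed_idx_max i T : en_index i T 0 -> allowed T 0 -> idx k0 T = #|T :\ k0|.
Proof.
move=> T0 all_T; congr #|pred_of_set _|; apply/setP => x; rewrite !inE andbC -val_eqE.
have [xT|] := boolP (x \in T); last by rewrite !andbF.
by have := allowed_le_max T0 all_T xT; rewrite ltn_neqAle => ->; rewrite !andbT.
Qed.

(** On the part with p = 0 and first element j0, the other elements of S range
    over a simplex on [V], which the last vertex k0 contracts. In step 0 this
    leaves one coordinate, at the pair {j0, k0}, and the augmentation maps it to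
    itself. *)
Lemma pivot_b i c : strand i c -> cycle i c ->
    (forall S p, c S p != 0 -> (p == 0)%N && (j0 \in S)) ->
  exists2 u, strand i.+1 u & forall S p, c S p = trunc i (dif u) S p.
Proof.
move=> str_c cyc_c supp_c.
(* Adding k0, the last element, to S :\ k0 has the sign (-1)^(#|S| - 1). *)
pose u S p : R := if (k0 \in S) && (p == 0)%N then (-1) ^+ #|S|.-1 * c (S :\ k0) 0%N else 0.
have str_u : strand i.+1 u.
  move=> S p; rewrite /u; case: ifP => [/andP[k0S /eqP->]|]; last by rewrite eqxx.
  rewrite mulrI_eq0; last exact: lreg_sign.
  case/str_c/andP=> [Sp all_S].
  have idx0 := allowed_idx_max Sp all_S.
  have k0T : k0 \notin S :\ k0 by rewrite setD11.
  have [+ _] := en_indexU1 k0T Sp; rewrite setD1K // => ->.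
  have := allowedU1_b (q := 0) k0T; rewrite idx0 setD1K // => ->; first by rewrite k0V.
  by rewrite (setD1_notin k0T); case/andP: Sp => /eqP->.
exists u => // S p.
set c1 := fun S p => c S p - trunc i (dif u) S p.
suff : c1 S p = 0 by move/eqP; rewrite subr_eq0 => /eqP.
have str1 : strand i c1 by exact: strand_sub_dif.
have cyc1 : cycle i c1 by exact: cycle_sub_dif.
have c1_p T q : (0 < q)%N -> c1 T q = 0.
  move=> q_gt0; have c0 : c T q = 0.
    by apply/eqP/negPn/negP => /supp_c; rewrite gtn_eqF.
  rewrite /c1 c0 /trunc; case: ifP => _; last by rewrite subr0.
  rewrite /en_dif big1 ?subr0 // => j _; rewrite /u andbF gtn_eqF // andbF.
  by rewrite !mulr0 addr0 mulr0.
have u1 T q : (0 < q)%N -> u T q = 0 by move=> q_gt0; rewrite /u gtn_eqF ?andbF.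
have c1_k0 T q : k0 \notin T -> c1 T q = 0.
  move=> k0T; have [->|/c1_p-> //] := posnP q.
  rewrite /c1 /trunc; case: ifP => T0; last first.
    by have [/str_c|/negPn/eqP->] := boolP (c T 0%N != 0); rewrite ?T0 ?subr0.
  rewrite (dif_pivot _ k0T) => [|j p' _ jk0]; last first.
    by rewrite /u !inE eq_sym (negbTE jk0) (negbTE k0T).
  rewrite u1 // mulr0 add0r /u setU11 setU1K // cardsU1 k0T add1n /=.
  have [/str_c/andP[_ all_T]|/negPn/eqP->] := boolP (c T 0%N != 0); last first.
    by rewrite !mulr0 subrr.
  rewrite (allowed_idx_max T0 all_T) setD1_notin //.
  by have /andP[/eqP-> _] := T0; rewrite mul1r signrMK subrr.
have c1_j0 T : j0 \notin T -> c1 T 0%N = 0.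
  move=> j0T; have [/supp_c|/negPn/eqP c0] := boolP (c T 0%N != 0).
    by rewrite (negbTE j0T).
  rewrite /c1 c0 sub0r; apply/eqP; rewrite oppr_eq0; apply/negPn/negP => nz.
  have /andP[T0 /(allowed_idx_min j0_min T0) idx0] := strand_trunc_dif str_u nz.
  case/negP: nz; rewrite /trunc T0 /en_dif big1 // => j jT.
  rewrite u1 // mulr0 add0r /takes_b !mulr1 /=.
  have [->|jj0] := eqVneq j j0; first by rewrite idx0 mul0r mulr0.
  rewrite /u; case: ifP => _; last by rewrite !mulr0.
  have [/supp_c|/negPn/eqP->] := boolP (c ((j |: T) :\ k0) 0%N != 0); last by rewrite !mulr0.
  by rewrite !inE [j0 == j]eq_sym (negbTE jj0) (negbTE j0T) !andbF.
apply/eqP/negPn/negP => c1_nz; have /andP[Sp all_S] := str1 S p c1_nz.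
have p0 : p = 0%N by apply/eqP; rewrite -leqn0 leqNgt; apply: contra c1_nz => /c1_p->.
have k0S : k0 \in S by apply: contraR c1_nz => /c1_k0->.
move: p0 c1_nz Sp all_S => -> c1_nz Sp all_S.
have j0S : j0 \in S by apply: contraR c1_nz => /c1_j0->.
have k0T : k0 \notin S :\ k0 by rewrite setD11.
have idxk := allowed_idx_max Sp all_S; have idxj := allowed_idx_min j0_min Sp all_S.
have cardT : #|S :\ k0| = i.+1.
  by case/andP: Sp => /eqP sS _; have := cardsD1 k0 S; rewrite k0S sS add1n => -[<-].
case: i {str_c str_u str1} @c1 cyc_c cyc1 c1_p c1_k0 c1_j0 Sp c1_nz cardT
  => [|i] c1 _ cyc1 c1_p c1_k0 c1_j0 Sp c1_nz cardT; last first.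
  have := cyc1 (S :\ k0) 0%N; rewrite /en_index cardT eqxx => /(_ isT).
  rewrite (dif_pivot _ k0T) => [|j p' _ jk0]; last first.
    by rewrite c1_k0 // !inE eq_sym (negbTE jk0) eqxx.
  rewrite -idxU1_self // setD1K // idxk cardT c1_p // mulr0 add0r mul1r => /eqP.
  by rewrite mulrI_eq0 ?(negbTE c1_nz) //; apply: lreg_sign.
have jk0 : j0 != k0 by apply/eqP => e; move: idxk; rewrite -e idxj e cardT.
have lt_jk : (j0 < k0)%N.
  by rewrite ltn_neqAle jk0; apply: allowed_le_max Sp all_S j0S.
have SE : S = [set j0; k0].
  apply/esym/eqP; rewrite eqEcard cards2 jk0.
  by case/andP: Sp => /eqP-> _; rewrite andbT subUset !sub1set j0S.
have c1_ne j k : k != j -> (j < k)%N -> (j, k) != (j0, k0) -> c1 [set j; k] 0%N = 0.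
  move=> kj lt; rewrite xpair_eqE negb_and => ne.
  have [k0jk|/c1_k0-> //] := boolP (k0 \in [set j; k]).
  have [j0jk|/c1_j0-> //] := boolP (j0 \in [set j; k]).
  move: k0jk j0jk ne; rewrite !inE -!val_eqE /=.
  by move=> *; exfalso; lia.
have := cyc1; rewrite /= /en_aug (bigD1 j0) //= (bigD1 k0) /=; last by rewrite eq_sym jk0.
rewrite [X in _ + X + _]big1 => [|k /andP[/andP[kj lt] kk0]]; last first.
  by rewrite c1_ne ?mulr0 // xpair_eqE (negbTE kk0) andbF.
rewrite [X in _ + X]big1 => [|j jj0]; last first.
  rewrite big1 // => k /andP[kj lt]; rewrite c1_ne ?mulr0 //.
  by rewrite xpair_eqE (negbTE jj0).
rewrite !addr0 ltnNge (ltnW lt_jk) /= !mul1r -SE => /eqP.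
by rewrite (negbTE c1_nz).
Qed.

End PivotB.

Lemma trunc_difD i c c' S p :
  trunc i (dif (fun S p => c S p + c' S p)) S p = trunc i (dif c) S p + trunc i (dif c') S p.
Proof.
rewrite /trunc; case: ifP => _; last by rewrite addr0.
rewrite -[dif c S p]mul1r -en_dif_linear; apply: eq_bigr => j _.
by rewrite !mul1r.
Qed.

(** The cone contractions from j0 = min U and k0 = max V, one after the other. *)
Theorem initial_exact i c : strand i c -> cycle i c ->
  exists2 u, strand i.+1 u & forall S p, c S p = trunc i (dif u) S p.
Proof.
move=> str_c cyc_c.
have trivial_c : (forall S p, c S p = 0) ->
    exists2 u, strand i.+1 u & forall S p, c S p = trunc i (dif u) S p.
  move=> c0; exists (fun _ _ => 0) => [S p|S p]; first by rewrite eqxx.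
  rewrite c0 /trunc /en_dif big1 ?if_same // => j _.
  by rewrite !mulr0 addr0 mulr0.
have [U0|[j jU]] := set_0Vmem U.
  apply: trivial_c => S p; apply/eqP/negPn/negP => /str_c/andP[/andP[/eqP sS _]].
  have [|k kS k0] := @idx_surj h 0 S; first by rewrite sS.
  by move=> /forall_inP/(_ k kS); rewrite k0 /= U0 inE.
have [V0|[k kV]] := set_0Vmem V.
  apply: trivial_c => S p; apply/eqP/negPn/negP => /str_c/andP[/andP[/eqP sS le_p]].
  have [|k kS kp] := @idx_surj h p.+1 S; first by rewrite sS; lia.
  by move=> /forall_inP/(_ k kS); rewrite kp ltnn V0 inE.
case: (arg_minnP (fun j : 'I_h => j : nat) jU) => j0 j0U j0_min.
case: (arg_maxnP (fun j : 'I_h => j : nat) kV) => k0 k0V k0_max.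
have [u1 str_u1 supp1] := pivot_a j0U j0_min str_c cyc_c.
have [u2 str_u2 eq2] := pivot_b j0U j0_min k0V k0_max (strand_sub_dif str_c str_u1)
  (cycle_sub_dif u1 cyc_c) supp1.
exists (fun S p => u1 S p + u2 S p) => [S p|S p].
  have [/str_u1 //|/negPn/eqP->] := boolP (u1 S p != 0).
  by rewrite add0r => /str_u2.
by rewrite trunc_difD -eq2 addrC subrK.
Qed.

End InitialStrand.

(** * Exactness over the polynomial ring *)

Section MonomialMatrix.

Variables (K : fieldType) (n h : nat).
Local Notation R := {mpoly K[n]}.
Variables (A B : 'I_h -> 'X_{1..n}) (path : 'I_n -> 'I_h) (wt : measure n).
Hypothesis A_path : forall j x, A j x != 0%N -> path x = j.
Hypothesis B_path : forall j x, B j x != 0%N -> path x = j.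
Hypothesis wtA : forall j, wt (A j) = 0%N.
Hypothesis wtB : forall j, wt (B j) = j.

Implicit Types (S T : {set 'I_h}) (j k : 'I_h) (m mu : 'X_{1..n}).

Definition letter S p k := if (idx k S <= p)%N then A k else B k.

(** The multidegree of the basis vector (S, p): the first p + 1 elements of S
    contribute an a, the others a b. *)
Definition basis_deg S p : 'X_{1..n} := (\sum_(k in S) letter S p k)%MM.

Lemma basis_degU1_a j T q : j \notin T -> (idx j T <= q.+1)%N ->
  basis_deg (j |: T) q.+1 = (A j + basis_deg T q)%MM.
Proof.
move=> jT le_q; rewrite /basis_deg big_setU1 //= {1}/letter idxU1_self // le_q.
by congr (_ + _)%MM; apply: eq_bigr => k kT; rewrite /letter idx_letter_a.
Qed.

Lemma basis_degU1_b j T q : j \notin T -> (q.+1 <= idx j T)%N ->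
  basis_deg (j |: T) q = (B j + basis_deg T q)%MM.
Proof.
move=> jT le_q; rewrite /basis_deg big_setU1 //= {1}/letter idxU1_self // leqNgt le_q.
by congr (_ + _)%MM; apply: eq_bigr => k kT; rewrite /letter idx_letter_b.
Qed.

(** Letters of different paths have disjoint supports, so their product divides
    [mu] as soon as each of them does. *)
Lemma basis_deg_le S p mu : (basis_deg S p <= mu)%MM =
  allowed [set k | (A k <= mu)%MM] [set k | (B k <= mu)%MM] S p.
Proof.
have letter_path k x : letter S p k x != 0%N -> path x = k.
  by rewrite /letter; case: ifP => _; [apply: A_path | apply: B_path].
transitivity [forall (k | k \in S), (letter S p k <= mu)%MM]; last first.
  by apply: eq_forallb_in => k kS; rewrite /letter; case: ifP; rewrite inE.
apply/mnm_lepP/forall_inP => [le_mu k kS | le_mu x].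
  apply/mnm_lepP => x; apply: leq_trans (le_mu x).
  by rewrite mnm_sumE (bigD1 k) //= leq_addr.
rewrite mnm_sumE; have [xS|xNS] := boolP (path x \in S); last first.
  rewrite big1 // => k kS; apply/eqP/negPn/negP => /letter_path xk.
  by rewrite xk kS in xNS.
rewrite (bigD1 (path x)) //= big1 ?addn0 => [|k /andP[kS kx]].
  exact: (mnm_lepP (le_mu _ xS)).
by apply/eqP/negPn/negP => /letter_path xk; rewrite xk eqxx in kx.
Qed.

Lemma wt_basis_deg S p :
  wt (basis_deg S p) = (\sum_(k in S | (p < idx k S)%N) k)%N.
Proof.
rewrite /basis_deg (big_morph wt (@mfD _ wt) (@mf0 _ wt)) [RHS]big_mkcondr /=.
by apply: eq_bigr => k _; rewrite /letter ltnNge; case: ifP; rewrite ?wtA ?wtB.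
Qed.

(** When a late [j] is removed with coefficient a, the letter b passes from [j]
    to the element of position [q.+1] in [T], which comes before [j]. *)
Lemma wt_wrong_a j T q : j \notin T -> (q.+1 < idx j T)%N ->
  (wt (A j + basis_deg T q)%MM < wt (basis_deg (j |: T) q.+1))%N.
Proof.
move=> jT lt_q; rewrite mfD wtA add0n !wt_basis_deg [X in (_ < X)%N]big_mkcondr.
rewrite big_setU1 //= idxU1_self // lt_q big_mkcondr /=.
have sub k : k \in T -> ((if (q < idx k T)%N then k : nat else 0) <=
    (if (q.+1 < idx k (j |: T))%N then k : nat else 0) +
    (if (idx k T == q.+1)%N then k : nat else 0))%N.
  move=> kT; rewrite idxU1 //; case: ltnP => // lt_qk.
  have : (q.+1 < (j < k) + idx k T)%N || (idx k T == q.+1).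
    by case: (ltnP j k) => [/ltnW/(idx_leq T)|] /=; lia.
  by case/orP=> ->; rewrite ?leq_addr ?leq_addl.
apply: leq_ltn_trans (leq_sum _ sub) _; rewrite big_split /= addnC ltn_add2r.
rewrite -big_mkcondr /=.
have lt_kj k : k \in T -> idx k T == q.+1 -> (k < j)%N.
  by move=> kT /eqP ik; rewrite ltnNge; apply/negP => /(idx_leq T); lia.
(* At most one element of [T] has position [q.+1], and it is less than [j]. *)
have [k /andP[kT ik]|none] := pickP (fun k => (k \in T) && (idx k T == q.+1)).
  rewrite (bigD1 k) ?kT //= big1 ?addn0 ?lt_kj // => k' /andP[/andP[k'T ik']].
  by case/eqP; apply: (idx_inj k'T kT); rewrite (eqP ik) (eqP ik').
rewrite big_pred0 //.
have [|k kT idxk] := @idx_surj h 0 T.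
  apply: leq_trans (_ : idx j T <= _)%N; first by lia.
  by apply: subset_leq_card; apply/subsetP => x; rewrite !inE => /andP[].
by apply: leq_ltn_trans (leq0n k) _; rewrite ltnNge; apply/negP => /(idx_leq T); lia.
Qed.

(** When an early [j] is removed with coefficient b, the letter b passes to [j]
    from the element of position [q] in [T], which comes after [j]. *)
Lemma wt_wrong_b j T q : j \notin T -> (q < #|T|)%N -> (idx j T <= q)%N ->
  (wt (B j + basis_deg T q)%MM < wt (basis_deg (j |: T) q))%N.
Proof.
move=> jT lt_q le_q; rewrite mfD wtB !wt_basis_deg [X in (_ < X)%N]big_mkcondr.
rewrite big_setU1 //= idxU1_self // [(q < idx j T)%N]ltnNge le_q add0n.
have [k kT idxk] := idx_surj lt_q.
have lt_jk : (j < k)%N.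
  rewrite ltn_neqAle; have -> /= : j != k :> nat by apply: contraNneq jT => /val_inj->.
  by rewrite leqNgt; apply/negP => /(idx_ltn kT); lia.
rewrite [X in (_ + X)%N]big_mkcondr (bigD1 k) //= [X in (_ < X)%N](bigD1 k) //=.
rewrite idxU1 // lt_jk idxk ltnn add1n ltnSn add0n.
apply: (@leq_ltn_trans (j + \sum_(i in T | i != k)
    (if (q < idx i (j |: T))%N then i : nat else 0))%N).
  rewrite leq_add2l; apply: leq_sum => i /andP[iT _]; rewrite idxU1 //.
  by case: ltnP => // lt; rewrite ltn_addl.
by rewrite ltn_add2r.
Qed.

(** The coefficient of [mu] in the product of [f] by the monomial [m]. *)
Definition coef_at mu m (f : R) : K := if (m <= mu)%MM then f@_(mu - m)%MM else 0.

Lemma coef_at_is_additive mu m : {morph coef_at mu m : f g / f - g}.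
Proof. by move=> f g; rewrite /coef_at; case: ifP; rewrite ?subr0 ?mcoeffB. Qed.

HB.instance Definition _ mu m :=
  GRing.isAdditive.Build R K (coef_at mu m) (@coef_at_is_additive mu m).

Lemma coef_at_sign mu m d f : coef_at mu m ((-1) ^+ d * f) = (-1) ^+ d * coef_at mu m f.
Proof. by elim: d => [|d IHd]; rewrite ?mul1r // !exprS -!mulrA !mulN1r raddfN /= IHd. Qed.

Lemma coef_at_mulX mu m m' f : coef_at mu m ('X_[m'] * f) = coef_at mu (m' + m)%MM f.
Proof.
have coefX mm : ('X_[m'] * f)@_mm = if (m' <= mm)%MM then f@_(mm - m')%MM else 0.
  case: ifP => le_m; first by rewrite -{1}(submK le_m) addmC mulrC mcoeffMX.
  apply: memN_msupp_eq0; rewrite mulrC (perm_mem (msuppMX f m')).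
  by apply/mapP => -[m1 _ em]; rewrite em lem_addr in le_m.
rewrite /coef_at coefX; case: ifP => le_m; last first.
  by case: ifP => // le_m'; rewrite (lepm_trans (lem_addl m' m) le_m') in le_m.
have -> : (m' <= mu - m)%MM = (m' + m <= mu)%MM.
  apply/mnm_lepP/mnm_lepP => le x; have := le x; have := mnm_lepP le_m x;
  by rewrite mnmDE mnmBE; lia.
by rewrite submDA addmC.
Qed.

Definition strand_at mu (v : {set 'I_h} -> nat -> R) S p := coef_at mu (basis_deg S p) (v S p).

(** All components of [v] have weight less than [N]. *)
Definition low N v := forall mu S p, (N <= wt mu)%N -> strand_at mu v S p = 0.

Lemma low_coef_at N v mu m S p : low N.+1 v -> (N <= wt mu)%N ->
  (wt m < wt (basis_deg S p))%N -> coef_at mu m (v S p) = 0.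
Proof.
move=> low_v le_N lt_m; rewrite /coef_at; case: ifP => // le_m.
have := low_v (mu - m + basis_deg S p)%MM S p.
rewrite /strand_at /coef_at lem_addl addmK; apply.
have : wt (mu - m + m)%MM = wt mu by rewrite submK.
by rewrite !mfD; lia.
Qed.

Variable eps : bool.

Local Notation a := (fun j => 'X_[A j] : R).
Local Notation b := (fun j => 'X_[B j] : R).
Local Notation dif := (en_dif eps a b).
Local Notation dif0 := (@en_dif K h false (fun=> 1) (fun=> 1)).
Local Notation aug := (en_aug eps a b).
Local Notation aug0 := (@en_aug K h false (fun=> 1) (fun=> 1)).

(** The terms that exist only for [eps = true] lower the weight. In weight at
    least [N] they would come from components of weight greater than [N], which
    vanish. *)
Lemma strand_at_dif N v mu i T q : low N.+1 v -> (N <= wt mu)%N -> en_index i T q ->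
  strand_at mu (dif v) T q = dif0 (strand_at mu v) T q.
Proof.
move=> low_v le_N /andP[/eqP sT le_q]; rewrite /strand_at /en_dif raddf_sum /=.
apply: eq_bigr => j jT; rewrite coef_at_sign raddfD /= /takes_a /takes_b !mulr1 -!mulrA.
congr (_ * (_ + _)).
  have [le_a|lt_a] /= := leqP (idx j T) q.+1.
    by rewrite orbT !mul1r coef_at_mulX basis_degU1_a.
  rewrite orbF mul0r; case: eps; last by rewrite mul0r raddf0.
  by rewrite mul1r coef_at_mulX (low_coef_at low_v) // wt_wrong_a.
have [le_b|lt_b] /= := leqP q.+1 (idx j T).
  by rewrite orbT !mul1r coef_at_mulX basis_degU1_b.
rewrite orbF mul0r; case: eps; last by rewrite mul0r raddf0.
rewrite mul1r coef_at_mulX (low_coef_at low_v) // wt_wrong_b //.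
by rewrite sT; lia.
Qed.

Lemma basis_deg2 j k : (j < k)%N -> basis_deg [set j; k] 0 = (A j + B k)%MM.
Proof.
move=> lt_jk; rewrite setUC [[set k] :|: _]/(k |: [set j]) basis_degU1_b.
- rewrite addmC; congr (_ + _)%MM; rewrite /basis_deg big_set1 /letter.
  by rewrite -[[set j]]setU0 idxU1_self ?inE // idx_set0.
- by rewrite inE -val_eqE /=; lia.
by rewrite -[[set j]]setU0 idxU1 ?inE // lt_jk.
Qed.

Lemma strand_at_aug N v mu : low N.+1 v -> (N <= wt mu)%N ->
  (aug v)@_mu = aug0 (strand_at mu v).
Proof.
move=> low_v le_N; have <- : coef_at mu 0%MM (aug v) = (aug v)@_mu.
  rewrite /coef_at; have -> : (0 <= mu)%MM by apply/mnm_lepP => x; rewrite mnm0E.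
  by rewrite subm0.
rewrite /en_aug raddf_sum; apply: eq_bigr => j _.
rewrite raddf_sum [LHS]big_mkcondr [RHS]big_mkcondr; apply: eq_bigr => k kj.
rewrite /= coef_at_sign !mul1r -mpolyXD coef_at_mulX addm0.
have [lt_jk|le_kj] := ltnP j k; first by rewrite orbT /strand_at basis_deg2.
have lt_kj : (k < j)%N by rewrite ltn_neqAle le_kj andbT.
rewrite orbF; case: eps => //; rewrite (low_coef_at low_v) ?mulr0 //.
by rewrite setUC basis_deg2 // !mfD !wtA !wtB.
Qed.

Lemma strand_at_cycle N v mu i : low N.+1 v -> (N <= wt mu)%N ->
  en_cycle eps a b i v -> en_cycle false (fun=> 1) (fun=> 1) i (strand_at mu v).
Proof.
case: i => [|i] low_v le_N /= cyc_v.
  by rewrite -(strand_at_aug low_v le_N) cyc_v mcoeff0.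
by move=> T q Tq; rewrite -(strand_at_dif low_v le_N Tq) /strand_at cyc_v // raddf0.
Qed.

Local Notation strand_mu mu :=
  (strand [set k | (A k <= mu)%MM] [set k | (B k <= mu)%MM]).

Definition lift_strand mu (c : {set 'I_h} -> nat -> K) S p : R :=
  c S p *: 'X_[mu - basis_deg S p].

Lemma strand_at_lift i mu c mu' S p : strand_mu mu i c ->
  strand_at mu' (lift_strand mu c) S p = if mu' == mu then c S p else 0.
Proof.
move=> str_c; rewrite /strand_at /lift_strand /coef_at mcoeffZ mcoeffX.
have [/str_c|/negPn/eqP->] := boolP (c S p != 0); last by rewrite mul0r !if_same.
rewrite -basis_deg_le => /andP[_ le_mu].
case: ifP => [le_mu'|nle_mu']; case: (mu' =P mu) => [e|ne].
- by rewrite e eqxx mulr1.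
- case: eqP => [e|]; last by rewrite mulr0.
  by case: ne; rewrite -(submK le_mu) -(submK le_mu') e.
- by rewrite e le_mu in nle_mu'.
- by [].
Qed.

Lemma strand_at_finite i v : (forall S p, ~~ en_index i S p -> v S p = 0) ->
  exists L : seq 'X_{1..n}, forall mu S p, mu \notin L -> strand_at mu v S p = 0.
Proof.
move=> supp_v; exists [seq (m + basis_deg x.1 x.2)%MM |
    x : {set 'I_h} * 'I_i.+1 <- enum {: {set 'I_h} * 'I_i.+1},
    m : 'X_{1..n} <- msupp (v x.1 x.2)] => mu S p.
apply: contraNeq; rewrite /strand_at /coef_at; case: ifP => [le_mu|]; last by rewrite eqxx.
rewrite -mcoeff_msupp => mu_v; have Sp : en_index i S p.
  by apply: contraLR mu_v => /supp_v->; rewrite msupp0.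
have lt_p : (p < i.+1)%N by case/andP: Sp.
apply/allpairsPdep; exists (S, Ordinal lt_p), (mu - basis_deg S p)%MM.
by rewrite mem_enum submK.
Qed.

Lemma strand_at_sub_dif N mu v u i S p : (forall S p, ~~ en_index i S p -> v S p = 0) ->
    low N.+1 u -> (N <= wt mu)%N ->
  strand_at mu (fun S p => v S p - trunc i (dif u) S p) S p =
  strand_at mu v S p - trunc i (dif0 (strand_at mu u)) S p.
Proof.
move=> supp_v low_u le_N; rewrite /strand_at raddfB /= /trunc; congr (_ - _).
case: ifP => Sp; last by rewrite raddf0.
by rewrite -(strand_at_dif low_u le_N Sp).
Qed.

(** Induction on the weight. A component of top weight is a cycle of the initial
    complex, hence a boundary there. Subtracting the differential of a lift of
    its primitive removes this component and otherwise changes only lower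
    weights. *)
Theorem en_exact i v : (forall S p, ~~ en_index i S p -> v S p = 0) ->
    en_cycle eps a b i v ->
  exists2 u, (forall S p, ~~ en_index i.+1 S p -> u S p = 0) &
    forall S p, v S p = trunc i (dif u) S p.
Proof.
move=> supp_v; have [L L_v] := strand_at_finite supp_v.
have [N low_v] : exists N, low N v.
  exists (\max_(mu <- L) (wt mu).+1)%N => mu S p le_N; apply: L_v.
  apply: contraL le_N => mu_L; rewrite -ltnNge.
  exact: (@leq_bigmax_seq _ L xpredT (fun mu => (wt mu).+1) mu mu_L isT).
elim: N v supp_v {L L_v} low_v => [|N IHN] v supp_v low_v cyc_v.
  exists (fun _ _ => 0) => // S p.
  have -> : v S p = 0.
    apply/mpolyP => m; have := low_v (m + basis_deg S p)%MM S p isT.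
    by rewrite /strand_at /coef_at lem_addl addmK mcoeff0.
  rewrite /trunc /en_dif big1 ?if_same // => j _.
  by rewrite !mulr0 addr0 mulr0.
have [L0 L_v] := strand_at_finite supp_v.
have {L_v} : forall mu, wt mu = N -> mu \notin L0 -> forall S p, strand_at mu v S p = 0.
  by move=> mu _ mu_L S p; apply: L_v.
(* The list contains every multidegree of weight N in which [v] is nonzero. *)
elim: L0 v supp_v low_v cyc_v => [|mu L IHL] v supp_v low_v cyc_v L_v.
  apply: IHN => // mu S p; rewrite leq_eqVlt => /orP[/eqP N_mu|]; last exact: low_v.
  exact: L_v.
have [wt_mu|wt_mu] := eqVneq (wt mu) N; last first.
  apply: IHL => // mu' wt_mu' mu'_L; apply: L_v => //.
  by rewrite inE negb_or mu'_L andbT; apply: contraNneq wt_mu => <-; apply/eqP.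
have str_v : strand_mu mu i (strand_at mu v).
  move=> S p nz; apply/andP; split.
    by apply: contraR nz => /supp_v v0; rewrite /strand_at v0 raddf0.
  rewrite -basis_deg_le; move: nz; rewrite /strand_at /coef_at.
  by case: ifP => //; rewrite eqxx.
have cyc_mu := strand_at_cycle low_v (eq_leq (esym wt_mu)) cyc_v.
have [c str_c eq_c] := initial_exact str_v cyc_mu.
have low_u : low N.+1 (lift_strand mu c).
  move=> mu' S p lt_N; rewrite (strand_at_lift _ _ _ str_c) //.
  by case: eqP lt_N => // ->; rewrite wt_mu ltnn.
pose v' S p := v S p - trunc i (dif (lift_strand mu c)) S p.
have strand_v' mu' S p : (N <= wt mu')%N -> strand_at mu' v' S p =
    if mu' == mu then 0 else strand_at mu' v S p.
  move=> le_N; rewrite (strand_at_sub_dif _ _ supp_v low_u le_N).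
  have -> : trunc i (dif0 (strand_at mu' (lift_strand mu c))) S p =
            if mu' == mu then trunc i (dif0 c) S p else 0.
    rewrite /trunc; case: ifP => Sp; last by rewrite if_same.
    case: eqP => [->|/eqP/negbTE ne]; last first.
      rewrite /en_dif big1 // => j _; rewrite !(strand_at_lift _ _ _ str_c) ne.
      by rewrite !mulr0 addr0 mulr0.
    apply: eq_bigr => j _; by rewrite !(strand_at_lift _ _ _ str_c) eqxx.
  by case: eqP => [->|]; rewrite ?subr0 // eq_c subrr.
have supp_v' S p : ~~ en_index i S p -> v' S p = 0.
  by move=> Sp; rewrite /v' supp_v // /trunc (negbTE Sp) subr0.
have low_v' : low N.+1 v'.
  by move=> mu' S p lt_N; rewrite strand_v' 1?ltnW // low_v // if_same.
have cyc_v' : en_cycle eps a b i v'.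
  apply: eq_en_cycle (en_cycleB_dif (lift_strand mu c) cyc_v) => S p Sp.
  by rewrite /v' /trunc Sp.
have [|u supp_u eq_u] := IHL v' supp_v' low_v' cyc_v'.
  move=> mu' wt_mu' mu'_L S p; rewrite strand_v' ?wt_mu' //; case: eqP => // /eqP ne.
  by apply: L_v; rewrite // inE negb_or ne.
exists (fun S p => 1 * lift_strand mu c S p + u S p) => S p.
  move=> Sp; rewrite supp_u // addr0 mul1r /lift_strand.
  have [/str_c/andP[]|/negPn/eqP->] := boolP (c S p != 0); last by rewrite scale0r.
  by rewrite (negbTE Sp).
have := eq_u S p; rewrite /v' /trunc; case: ifP => Sp.
  by rewrite en_dif_linear mul1r => /eqP; rewrite subr_eq addrC => /eqP.
by rewrite supp_v ?Sp.
Qed.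

End MonomialMatrix.

(** * The minimal graded resolution and its Betti numbers *)

(** The matrix is P^T P, where P selects the basis vectors of degree [j] and P
    P^T = 1. *)
Lemma rank_degree_part (K : fieldType) r (d : 'I_r -> nat) j :
  \rank (degree_part K d j) = #|[pred a | d a == j]|.
Proof.
set D := [pred a | d a == j].
have [P PE] : exists P : 'M[K]_(#|D|, r), forall k a, P k a = (enum_val k == a)%:R.
  by exists (\matrix_(k, a) (enum_val k == a)%:R) => k a; rewrite mxE.
have PPT : P *m P^T = 1%:M.
  apply/matrixP => k k'; rewrite mxE (bigD1 (enum_val k)) //= big1 => [|a ne].
    by rewrite mxE !PE eqxx mul1r addr0 mxE (inj_eq enum_val_inj) eq_sym.
  by rewrite PE eq_sym (negbTE ne) mul0r.
have PTP : P^T *m P = degree_part K d j.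
  apply/matrixP => a b; rewrite !mxE.
  under eq_bigr => k _ do rewrite mxE !PE.
  have [Da|nDa] := boolP (a \in D); last first.
    rewrite big1 => [|k _]; last first.
      by case: eqP (enum_valP k) => [->|_ _]; rewrite ?(negbTE nDa) ?mul0r.
    by move: nDa; rewrite inE => /negbTE->; rewrite mul0rn.
  rewrite (bigD1 (enum_rank_in Da a)) //= big1 ?addr0 => [|k].
    by rewrite enum_rankK_in // eqxx mul1r; move: Da; rewrite inE => ->.
  move=> ne; case: eqP => [ea|]; rewrite ?mul0r //; case/eqP: ne.
  by apply: enum_val_inj; rewrite enum_rankK_in.
have eqDP : (degree_part K d j :=: P)%MS.
  apply/eqmxP/andP; split; first by rewrite -PTP submxMl.
  by rewrite -[X in (X <= _)%MS]mul1mx -PPT -mulmxA PTP submxMl.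
rewrite eqDP; apply/eqP; rewrite -[_ == _]/(row_free P); apply/row_freeP.
by exists P^T.
Qed.

Lemma tor_dim_minimal (K : fieldType) n (I : {mpoly K[n]} -> Prop)
    (F : graded_free_resolution I) i j :
  (forall k, tensor_dif F k = 0) -> tor_dim F i j = #|[pred a | @res_deg _ _ _ F i a == j]|.
Proof.
move=> dif0; rewrite /tor_dim /tensor_boundaries dif0 mulmx0 mxrank0 subn0.
rewrite -(rank_degree_part K); case: i => [|i] //=.
by apply: eqmx_rank; apply/eqmxP/capmx_idPl; rewrite sub_kermx dif0 mulmx0.
Qed.

Section Resolution.

Variables (K : fieldType) (n h : nat).
Local Notation R := {mpoly K[n]}.
Variables (A B : 'I_h -> 'X_{1..n}) (path : 'I_n -> 'I_h) (wt : measure n).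
Hypothesis A_path : forall j x, A j x != 0%N -> path x = j.
Hypothesis B_path : forall j x, B j x != 0%N -> path x = j.
Hypothesis wtA : forall j, wt (A j) = 0%N.
Hypothesis wtB : forall j, wt (B j) = j.
Variable l : 'I_h -> nat.
Hypothesis l_gt0 : forall j, (0 < l j)%N.
Hypothesis degA : forall j, mdeg (A j) = l j.
Hypothesis degB : forall j, mdeg (B j) = l j.

Variable eps : bool.
Local Notation a := (fun j => 'X_[A j] : R).
Local Notation b := (fun j => 'X_[B j] : R).
Local Notation dif := (en_dif eps a b).
Local Notation aug := (en_aug eps a b).
Implicit Types (S T : {set 'I_h}).

Definition en_basis i := {x : {set 'I_h} * 'I_h | en_index i x.1 x.2}.
Definition en_rank i := #|{: en_basis i}|.
Definition basis_set i (x : 'I_(en_rank i)) : {set 'I_h} := (val (enum_val x)).1.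
Definition basis_pos i (x : 'I_(en_rank i)) : nat := (val (enum_val x)).2.

Lemma basis_index i (x : 'I_(en_rank i)) : en_index i (basis_set x) (basis_pos x).
Proof. exact: valP (enum_val x). Qed.

Lemma basis_onto i S p : en_index i S p ->
  exists x : 'I_(en_rank i), S = basis_set x /\ p = basis_pos x.
Proof.
move=> Sp; have lt_p : (p < h)%N.
  by case/andP: Sp => /eqP sS; have := max_card (mem S); rewrite card_ord sS; lia.
exists (enum_rank (exist _ (S, Ordinal lt_p) Sp : en_basis i)).
by rewrite /basis_set /basis_pos enum_rankK.
Qed.

Lemma basis_inj i (x y : 'I_(en_rank i)) :
  basis_set x = basis_set y -> basis_pos x = basis_pos y -> x = y.
Proof.
move=> eS ep; apply: enum_val_inj; apply: val_inj.
move: eS ep; rewrite /basis_set /basis_pos.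
case: (val (enum_val x)) (val (enum_val y)) => [S p] [S' p'] /= -> /val_inj -> //.
Qed.

Definition basis_fun i (x : 'I_(en_rank i)) S p : R :=
  ((S == basis_set x) && (p == basis_pos x))%:R.

(** Row vectors and families of coordinates correspond to each other by
    [coef_fun] and [coef_row]; the matrices of the resolution are those of
    [en_dif] and [en_aug] in this correspondence. *)
Definition coef_fun i (v : 'rV[R]_(en_rank i)) S p : R :=
  \sum_x v 0 x * basis_fun x S p.

Definition coef_row i (v : {set 'I_h} -> nat -> R) : 'rV[R]_(en_rank i) :=
  \row_x v (basis_set x) (basis_pos x).

Lemma coef_fun_basis i (v : 'rV[R]_(en_rank i)) x :
  coef_fun v (basis_set x) (basis_pos x) = v 0 x.
Proof.
rewrite /coef_fun (bigD1 x) //= /basis_fun !eqxx mulr1 big1 ?addr0 // => y ne.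
case: andP => [[/eqP eS /eqP ep]|]; last by rewrite mulr0.
by case/eqP: ne; apply: basis_inj.
Qed.

Lemma coef_fun_out i (v : 'rV[R]_(en_rank i)) S p : ~~ en_index i S p -> coef_fun v S p = 0.
Proof.
move=> Sp; rewrite /coef_fun big1 // => x _; rewrite /basis_fun.
case: andP => [[/eqP eS /eqP ep]|]; last by rewrite mulr0.
by rewrite eS ep basis_index in Sp.
Qed.

Lemma coef_rowK i v S p : coef_fun (coef_row i v) S p = trunc i v S p.
Proof.
rewrite /trunc; case: ifP => [|/negbT Sp]; last exact: coef_fun_out.
by case/basis_onto=> x [-> ->]; rewrite coef_fun_basis mxE.
Qed.

Lemma coef_funK i (v : 'rV[R]_(en_rank i)) : coef_row i (coef_fun v) = v.
Proof. by apply/rowP => x; rewrite mxE coef_fun_basis. Qed.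

Lemma en_dif_sum (J : finType) (c : J -> R) (f : J -> {set 'I_h} -> nat -> R) T q :
  dif (fun S p => \sum_x c x * f x S p) T q = \sum_x c x * dif (f x) T q.
Proof.
under [RHS]eq_bigr => x _ do rewrite mulr_sumr.
rewrite exchange_big; apply: eq_bigr => j _ /=.
by rewrite !mulr_sumr -big_split mulr_sumr; apply: eq_bigr => x _ /=; ring.
Qed.

Lemma en_aug_sum (J : finType) (c : J -> R) (f : J -> {set 'I_h} -> nat -> R) :
  aug (fun S p => \sum_x c x * f x S p) = \sum_x c x * aug (f x).
Proof.
under [RHS]eq_bigr => x _ do rewrite mulr_sumr.
rewrite exchange_big; apply: eq_bigr => j _ /=.
under [RHS]eq_bigr => x _ do rewrite mulr_sumr.
rewrite exchange_big; apply: eq_bigr => k _ /=.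
by rewrite !mulr_sumr; apply: eq_bigr => x _ /=; ring.
Qed.

Definition en_mx i : 'M[R]_(en_rank i.+1, en_rank i) :=
  \matrix_(x, y) dif (basis_fun x) (basis_set y) (basis_pos y).

Definition en_aug_mx : 'cV[R]_(en_rank 0) := \col_x aug (basis_fun x).

Lemma mul_en_mx i v : v *m en_mx i = coef_row i (dif (coef_fun v)).
Proof.
apply/rowP => y; rewrite !mxE en_dif_sum; apply: eq_bigr => x _.
by rewrite mxE.
Qed.

Lemma mul_en_aug_mx v : (v *m en_aug_mx) 0 0 = aug (coef_fun v).
Proof. by rewrite mxE en_aug_sum; apply: eq_bigr => x _; rewrite mxE. Qed.

Definition en_deg i (x : 'I_(en_rank i)) : nat := \sum_(j in basis_set x) l j.

Lemma signed_homog d k (f : R) : f \is d.-homog -> (-1) ^+ k * f \is d.-homog.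
Proof.
move=> hom_f; rewrite -signr_odd; case: odd; first by rewrite mulN1r rpredN.
by rewrite mul1r.
Qed.

Lemma bool_homog d (c : bool) (f : R) : f \is d.-homog -> c%:R * f \is d.-homog.
Proof. by move=> hom_f; case: c; rewrite ?mul1r // mul0r rpred0. Qed.

Lemma en_mx_homog i (x : 'I_(en_rank i.+1)) y m :
  m \in msupp (en_mx i x y) -> (mdeg m + en_deg y)%N = en_deg x.
Proof.
have [le|gt] := leqP (en_deg y) (en_deg x); last first.
  suff -> : en_mx i x y = 0 by rewrite msupp0.
  rewrite mxE /en_dif big1 // => j jT; rewrite /basis_fun.
  case: eqP => [ex|_]; last by rewrite !mulr0 addr0 mulr0.
  by move: gt; rewrite /en_deg -ex big_setU1 //=; lia.
suff /dhomogP hom : en_mx i x y \is (en_deg x - en_deg y)%N.-homog.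
  by move/hom => /= ->; rewrite subnK.
rewrite mxE /en_dif; apply: rpred_sum => j jT; apply: signed_homog.
rewrite /basis_fun; case: eqP => [ex|_]; last by rewrite !mulr0 addr0 rpred0.
have -> : (en_deg x - en_deg y)%N = l j by rewrite /en_deg -ex big_setU1 //= addnK.
by apply: rpredD; rewrite mulrC; do 2!apply: bool_homog; rewrite dhomogX /= ?degA ?degB.
Qed.

Lemma en_aug_homog (x : 'I_(en_rank 0)) m :
  m \in msupp (en_aug_mx x ord0) -> mdeg m = en_deg x.
Proof.
suff /dhomogP hom : en_aug_mx x ord0 \is (en_deg x).-homog by move/hom.
rewrite mxE /en_aug; apply: rpred_sum => j _; apply: rpred_sum => k /andP[kj _].
apply: signed_homog; rewrite /basis_fun; case: eqP => [ex|_]; last by rewrite mulr0 rpred0.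
rewrite mulrC; apply: bool_homog; rewrite -mpolyXD dhomogX /= mdegD degA degB.
by rewrite /en_deg -ex big_setU1 ?big_set1 // inE eq_sym.
Qed.

(** Minimality: the nonzero entries are signed monomials of positive degree. *)
Lemma en_mx_const i : map_mx (mcoeff 0%MM) (en_mx i) = 0.
Proof.
have X0 m : mdeg m != 0%N -> ('X_[m] : R)@_0%MM = 0.
  by rewrite mdeg_eq0 mcoeffX => /negbTE->.
apply/matrixP => x y; rewrite !mxE raddf_sum big1 // => j _ /=.
rewrite rmorphM rmorphD !rmorphM /= !X0 ?degA ?degB -?lt0n //.
by rewrite !(mulr0, mul0r) addr0 mulr0.
Qed.

Variable I : R -> Prop.
Hypothesis I_aug : forall p, I p <-> exists v, aug v = p.

Lemma en_exact_aug p : I p <-> exists v : 'rV_(en_rank 0), (v *m en_aug_mx) ord0 ord0 = p.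
Proof.
split=> [/I_aug[u <-]|[v <-]]; last first.
  by apply/I_aug; exists (coef_fun v); rewrite mul_en_aug_mx.
exists (coef_row 0 u); rewrite mul_en_aug_mx; apply: eq_en_aug => S p' Sp.
by rewrite coef_rowK /trunc Sp.
Qed.

Lemma en_exact_row i (v : 'rV[R]_(en_rank i)) :
  en_cycle eps a b i (coef_fun v) <-> exists w, w *m en_mx i = v.
Proof.
split=> [cyc_v|[w <-]].
  have [|u supp_u eq_u] := en_exact A_path B_path wtA wtB _ cyc_v.
    exact: coef_fun_out.
  exists (coef_row i.+1 u); rewrite mul_en_mx -[RHS]coef_funK; apply/rowP => x.
  rewrite !mxE eq_u /trunc basis_index; apply: eq_en_dif (basis_index x) => S p Sp.
  by rewrite coef_rowK /trunc Sp.
apply: eq_en_cycle (en_cycle_dif _ _ _ i (coef_fun w)) => S p Sp.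
by rewrite mul_en_mx coef_rowK /trunc Sp.
Qed.

Lemma en_exact0 (v : 'rV[R]_(en_rank 0)) :
  v *m en_aug_mx = 0 <-> exists w, w *m en_mx 0 = v.
Proof.
rewrite -en_exact_row /= -mul_en_aug_mx; split=> [->|v0]; first by rewrite mxE.
by apply/matrixP => x y; rewrite (ord1 x) (ord1 y) v0 mxE.
Qed.

Lemma en_exactS i (v : 'rV[R]_(en_rank i.+1)) :
  v *m en_mx i = 0 <-> exists w, w *m en_mx i.+1 = v.
Proof.
rewrite -en_exact_row /= mul_en_mx; split=> [/rowP v0 T q Tq|v0].
  by have [x [-> ->]] := basis_onto Tq; have := v0 x; rewrite !mxE.
by apply/rowP => x; rewrite !mxE v0 // basis_index.
Qed.

Definition en_resolution : graded_free_resolution I :=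
  GradedFreeResolution en_aug_homog en_mx_homog en_exact_aug en_exact0 en_exactS.

Lemma betti_en i j :
  betti I i j = #|[pred x : 'I_(en_rank i) | en_deg x == j]|.
Proof.
rewrite (betti_resolution en_resolution) tor_dim_minimal // => k.
exact: en_mx_const.
Qed.

End Resolution.

(** * The fibres of the toric map *)

Section ToricIdeal.

Variables (h : nat) (l : 'I_h -> nat) (l_gt0 : forall j, (0 < l j)%N).
Local Notation G := (B_graph l_gt0).
Local Notation n := #|edge G|.
Implicit Types (j k : 'I_h) (m : 'X_{1..n}).

Definition var_edge (x : 'I_n) : B_edge l := enum_val x.
Definition edge_var j (p : 'I_(2 * l j)) : 'I_n :=
  enum_rank (Tagged (fun j => 'I_(2 * l j)) p : edge G).

Lemma edge_varK j (p : 'I_(2 * l j)) : var_edge (edge_var p) = Tagged _ p.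
Proof. exact: enum_rankK. Qed.

Lemma var_edgeK x : edge_var (tagged (var_edge x)) = x.
Proof.
rewrite /edge_var /var_edge; have -> (e : B_edge l) :
  Tagged (fun j => 'I_(2 * l j)) (tagged e) = e by case: e.
exact: enum_valK.
Qed.

Lemma edge_varP x : exists j p, x = @edge_var j p.
Proof. by exists (tag (var_edge x)), (tagged (var_edge x)); rewrite var_edgeK. Qed.

Lemma sum_vars (F : 'I_n -> nat) :
  (\sum_x F x = \sum_j \sum_(p < 2 * l j) F (edge_var p))%N.
Proof.
rewrite sig_big_dep /=.
rewrite (reindex var_edge) /=; first by apply: eq_bigr => x _; rewrite var_edgeK.
by apply: onW_bij; apply: enum_val_bij.
Qed.

Definition odd_edges j : 'X_{1..n} :=
  [multinom ((tag (var_edge x) == j) && ~~ odd (tagged (var_edge x)) : nat) | x < n].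
Definition even_edges j : 'X_{1..n} :=
  [multinom ((tag (var_edge x) == j) && odd (tagged (var_edge x)) : nat) | x < n].

Lemma odd_edgesE j k (p : 'I_(2 * l k)) :
  odd_edges j (edge_var p) = (k == j) && ~~ odd p.
Proof. by rewrite mnmE edge_varK. Qed.

Lemma even_edgesE j k (p : 'I_(2 * l k)) :
  even_edges j (edge_var p) = (k == j) && odd p.
Proof. by rewrite mnmE edge_varK. Qed.

Lemma odd_edges_path j x : odd_edges j x != 0%N -> tag (var_edge x) = j.
Proof. by rewrite mnmE; case: (tag _ =P j). Qed.

Lemma even_edges_path j x : even_edges j x != 0%N -> tag (var_edge x) = j.
Proof. by rewrite mnmE; case: (tag _ =P j). Qed.

Lemma sum_odd_bool q : (\sum_(p < 2 * q) odd p = q)%N /\ (\sum_(p < 2 * q) ~~ odd p = q)%N.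
Proof.
elim: q => [|q [IH1 IH2]]; first by rewrite muln0 !big_ord0.
rewrite mulnS !big_ord_recr /= IH1 IH2 oddM /=; lia.
Qed.

Lemma mdeg_odd_edges j : mdeg (odd_edges j) = l j.
Proof.
rewrite mdegE sum_vars (bigD1 j) //= [X in (_ + X)%N]big1 ?addn0 => [|k kj]; last first.
  by rewrite big1 // => p _; rewrite odd_edgesE (negbTE kj).
rewrite -[RHS](proj2 (sum_odd_bool (l j))).
by apply: eq_bigr => p _; rewrite odd_edgesE eqxx.
Qed.

Lemma mdeg_even_edges j : mdeg (even_edges j) = l j.
Proof.
rewrite mdegE sum_vars (bigD1 j) //= [X in (_ + X)%N]big1 ?addn0 => [|k kj]; last first.
  by rewrite big1 // => p _; rewrite even_edgesE (negbTE kj).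
rewrite -[RHS](proj1 (sum_odd_bool (l j))).
by apply: eq_bigr => p _; rewrite even_edgesE eqxx.
Qed.

(** An additive function that takes the value 0 on every a_j and j on every b_j:
    the second edge of a path is an even edge, and there is exactly one on each
    path. *)
Definition second_edge_wt m : nat :=
  \sum_x (if (tagged (var_edge x) == 1 :> nat) then tag (var_edge x) : nat else 0) * m x.

Lemma second_edge_wt0 : second_edge_wt 0%MM = 0%N.
Proof. by rewrite /second_edge_wt big1 // => x _; rewrite mnm0E muln0. Qed.

Lemma second_edge_wtD : {morph second_edge_wt : m1 m2 / (m1 + m2)%MM >-> (m1 + m2)%N}.
Proof.
move=> m1 m2; rewrite /second_edge_wt -big_split; apply: eq_bigr => x _.
by rewrite mnmDE mulnDr.
Qed.

HB.instance Definition _ := isMeasure.Build n second_edge_wt second_edge_wt0 second_edge_wtD.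

Lemma wt_odd_edges j : second_edge_wt (odd_edges j) = 0%N.
Proof.
rewrite /second_edge_wt big1 // => x _; rewrite mnmE.
by case: ifP => [/eqP->|]; rewrite ?andbF ?muln0.
Qed.

Lemma wt_even_edges j : second_edge_wt (even_edges j) = j.
Proof.
rewrite /second_edge_wt sum_vars (bigD1 j) //= [X in (_ + X)%N]big1 => [|k kj]; last first.
  by rewrite big1 // => p _; rewrite even_edgesE (negbTE kj) muln0.
have lt1 : (1 < 2 * l j)%N by have := l_gt0 j; lia.
rewrite addn0 (bigD1 (Ordinal lt1)) //= big1 => [|p]; rewrite edge_varK even_edgesE eqxx /=.
  by rewrite muln1 addn0.
by rewrite -val_eqE /= => /negbTE->.
Qed.

(** The exponent of the variable [v] in the image of the monomial [m]. *)
Definition vdeg m (v : B_vertex l) : nat := \sum_x m x * (v \in B_ends (var_edge x)).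

Lemma vdegD m1 m2 v : vdeg (m1 + m2)%MM v = (vdeg m1 v + vdeg m2 v)%N.
Proof.
by rewrite /vdeg -big_split; apply: eq_bigr => x _; rewrite mnmDE mulnDl.
Qed.

Lemma path_vertex0 j p : (path_vertex l j p == inl false) = (p == 0)%N.
Proof.
by apply/eqP/eqP => [|-> //]; rewrite /path_vertex; case: eqP => // _; case: insubP.
Qed.

Lemma path_vertex_end j p : (p <= 2 * l j)%N ->
  (path_vertex l j p == inl true) = (p == 2 * l j)%N.
Proof.
have lj := l_gt0 j => le_p; apply/eqP/eqP => [|->]; rewrite /path_vertex.
  by case: (p =P 0)%N => // p_gt0; case: insubP => // ge_p _; lia.
by case: (_ =P 0)%N; [lia | case: insubP => // u lt_u; lia].
Qed.

Definition first_pos j : 'I_(2 * l j) :=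
  Ordinal (leq_trans (ltnW (ltnSn 1)) (leq_pmulr 2 (l_gt0 j))).
Definition last_pos j : 'I_(2 * l j) := rev_ord (first_pos j).
Definition start_edge j : 'I_n := edge_var (first_pos j).
Definition end_edge j : 'I_n := edge_var (last_pos j).

Lemma vdeg_start m : vdeg m (inl false) = (\sum_j m (start_edge j))%N.
Proof.
rewrite /vdeg sum_vars; apply: eq_bigr => j _; rewrite (bigD1 (first_pos j)) //=.
rewrite edge_varK !inE !(eq_sym (inl false)) !path_vertex0 muln1 big1 ?addn0 // => p.
rewrite -val_eqE /= => /negbTE p0; rewrite edge_varK !inE !(eq_sym (inl false)).
by rewrite !path_vertex0 p0 muln0.
Qed.

Lemma vdeg_end m : vdeg m (inl true) = (\sum_j m (end_edge j))%N.
Proof.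
rewrite /vdeg sum_vars; apply: eq_bigr => j _; rewrite (bigD1 (last_pos j)) //=.
have lj := l_gt0 j.
rewrite edge_varK !inE !(eq_sym (inl true)) !path_vertex_end /=; try lia.
have -> : ((2 * l j - 1).+1 == 2 * l j)%N by lia.
rewrite orbT muln1 big1 ?addn0 // => p.
rewrite -val_eqE /= => ne_p; rewrite edge_varK !inE !(eq_sym (inl true)).
have lt_p := ltn_ord p; rewrite !path_vertex_end //=; try lia.
Qed.

Lemma vdeg_inner m j (p : 'I_(2 * l j)) (q : 'I_(2 * l j)) : q = p.+1 :> nat ->
  vdeg m (path_vertex l j q) = (m (edge_var p) + m (edge_var q))%N.
Proof.
move=> qE; have lt_q := ltn_ord q.
have q_int : (0 < q < 2 * l j)%N by rewrite lt_q qE.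
have inE_q k (p' : 'I_(2 * l k)) : (path_vertex l j q \in B_ends (var_edge (edge_var p'))) =
    (k == j) && (p' == q :> nat) || (k == j) && (p' == p :> nat).
  have lt_p' := ltn_ord p'.
  rewrite edge_varK !inE /=; congr (_ || _).
    apply/eqP/andP => [/(path_vertex_inj q_int (ltnW lt_p'))[ek ep]|[/eqP ek /eqP ep]].
      by split; apply/eqP; [exact: esym | exact: esym].
    by rewrite ep ek.
  apply/eqP/andP => [/(path_vertex_inj q_int lt_p')[ek ep]|[/eqP ek /eqP ep]].
    by split; apply/eqP; [exact: esym | lia].
  by rewrite ep ek qE.
rewrite /vdeg sum_vars (bigD1 j) //= [X in (_ + X)%N]big1 ?addn0 => [|k kj]; last first.
  by rewrite big1 // => p' _; rewrite inE_q (negbTE kj) muln0.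
rewrite (bigD1 p) //= (bigD1 q) /=; last by rewrite -val_eqE /= qE; lia.
rewrite [X in (_ + (_ + X))%N]big1 ?addn0 => [|p' /andP[ne_p ne_q]]; last first.
  rewrite inE_q eqxx /=; move: ne_p ne_q; rewrite -!val_eqE /= => /negbTE-> /negbTE->.
  by rewrite muln0.
by rewrite !inE_q !eqxx /= orbT !muln1.
Qed.

Lemma vertexP (v : B_vertex l) :
  [\/ v = inl false, v = inl true |
      exists j (p q : 'I_(2 * l j)), q = p.+1 :> nat /\ v = path_vertex l j q].
Proof.
case: v => [[]|[j k]]; [exact: Or32 | exact: Or31 | apply: Or33].
have lt_k := ltn_ord k; have lt_p : (k < 2 * l j)%N by lia.
have lt_q : (k.+1 < 2 * l j)%N by lia.
exists j, (Ordinal lt_p), (Ordinal lt_q); split=> //=.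
by rewrite /path_vertex /= valK.
Qed.

(** Both a_j and b_j cover every inner vertex of the j-th path once; in addition
    a_j covers y_1 and b_j covers y_2. *)
Lemma vdeg_swap j k v :
  vdeg (odd_edges j + even_edges k)%MM v = vdeg (odd_edges k + even_edges j)%MM v.
Proof.
have sum1 i : (\sum_(i' < h) (i' == i) = 1)%N.
  by rewrite (bigD1 i) //= eqxx big1 // => i' /negbTE->.
rewrite !vdegD; case: (vertexP v) => [->|->|[i [p [q [qE ->]]]]].
- rewrite !vdeg_start; have odd1 i : (\sum_i' odd_edges i (start_edge i') = 1)%N.
    by rewrite -(sum1 i); apply: eq_bigr => i' _; rewrite odd_edgesE andbT.
  by rewrite !odd1 !big1 // => i _; rewrite even_edgesE andbF.
- have odd_last i : odd (last_pos i) by rewrite /=; have := l_gt0 i; lia.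
  rewrite !vdeg_end; have even1 i : (\sum_i' even_edges i (end_edge i') = 1)%N.
    by rewrite -(sum1 i); apply: eq_bigr => i' _; rewrite even_edgesE odd_last andbT.
  by rewrite !even1 !big1 // => i _; rewrite odd_edgesE odd_last andbF.
rewrite !(vdeg_inner _ qE) !odd_edgesE !even_edgesE qE /=.
by case: odd; rewrite /= ?andbT ?andbF ?addn0 ?add0n addnC.
Qed.

(** The monomials that turn out to lie outside the initial ideal. *)
Definition standard m := forall j k, (j < k)%N -> ~~ (odd_edges j + even_edges k <= m)%MM.

Lemma odd_even_le m j k : j != k ->
    (forall p : 'I_(2 * l j), ~~ odd p -> (0 < m (edge_var p))%N) ->
    (forall p : 'I_(2 * l k), odd p -> (0 < m (edge_var p))%N) ->
  (odd_edges j + even_edges k <= m)%MM.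
Proof.
move=> jk odd_m even_m; apply/mnm_lepP => x; have [i [p ->]] := edge_varP x.
rewrite mnmDE odd_edgesE even_edgesE; case: (i =P j) => [ij|_] /=.
  case: j / ij jk odd_m => jk odd_m; rewrite (negbTE jk) addn0.
  by case: (boolP (odd p)) => //= /odd_m.
case: (i =P k) => [ik|_] //=; case: k / ik {jk} even_m => even_m.
by case: (boolP (odd p)) => //= /even_m.
Qed.

(** At an inner vertex the exponents of the two edges have the same sum in [m]
    and in [m'], so the difference of [m] and [m'] changes sign from each edge
    of a path to the next. *)
Lemma fiber_path m m' j (p : 'I_(2 * l j)) : vdeg m =1 vdeg m' ->
  if odd p then (m (edge_var p) + m (start_edge j) = m' (edge_var p) + m' (start_edge j))%N
  else (m (edge_var p) + m' (start_edge j) = m' (edge_var p) + m (start_edge j))%N.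
Proof.
move=> eq_v; case: p => p; elim: p => [|p IHp] lt_p /=.
  have -> : edge_var (Ordinal lt_p) = start_edge j by congr edge_var; apply: val_inj.
  by rewrite addnC.
have lt_p' : (p < 2 * l j)%N by apply: ltnW.
have := eq_v (path_vertex l j p.+1); have := IHp lt_p'.
rewrite !(@vdeg_inner _ j (Ordinal lt_p') (Ordinal lt_p)) //=.
by case: odd => /=; lia.
Qed.

(** Let [m] exceed [m'] at the start of path j. Since the degrees at y_1 agree,
    [m] falls short of [m'] at the start of another path k. As the difference
    alternates along paths, a_j b_k divides [m] and a_k b_j divides [m'], and
    one of the two divisors has the forbidden order. *)
Lemma standard_unique m m' : vdeg m =1 vdeg m' -> standard m -> standard m' -> m = m'.
Proof.
wlog [j lt_j] : m m' / exists j, (m' (start_edge j) < m (start_edge j))%N.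
  move=> wl eq_v std_m std_m'.
  have [j lt_j|ge_m] := pickP (fun j => m' (start_edge j) < m (start_edge j))%N.
    by apply: wl => //; exists j.
  have [j lt_j|ge_m'] := pickP (fun j => m (start_edge j) < m' (start_edge j))%N.
    by apply/esym/wl => //; exists j.
  apply/mnmP => x; have [j [p ->]] := edge_varP x.
  by have := fiber_path p eq_v; have := ge_m j; have := ge_m' j; case: ifP => _; lia.
move=> eq_v std_m std_m'.
have [k lt_k] : exists k, (m (start_edge k) < m' (start_edge k))%N.
  have [k lt_k|ge] := pickP (fun k => m (start_edge k) < m' (start_edge k))%N.
    by exists k.
  have := eq_v (inl false); rewrite !vdeg_start (bigD1 j) //= [RHS](bigD1 j) //=.
  have : (\sum_(i | i != j) m' (start_edge i) <= \sum_(i | i != j) m (start_edge i))%N.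
    by apply: leq_sum => i _; rewrite leqNgt ge.
  by move=> le_s eq_s; have := leq_add lt_j le_s; rewrite eq_s addSn ltnn.
have jk : j != k by apply: contraTneq lt_j => ->; rewrite -leqNgt ltnW.
have jk_m : (odd_edges j + even_edges k <= m)%MM.
  apply: odd_even_le => // p; first by have := fiber_path p eq_v; case: ifP => //; lia.
  by have := fiber_path p eq_v; case: ifP => //; lia.
have kj_m' : (odd_edges k + even_edges j <= m')%MM.
  apply: odd_even_le => [|p|p]; first by rewrite eq_sym.
    by have := fiber_path p eq_v; case: ifP => //; lia.
  by have := fiber_path p eq_v; case: ifP => //; lia.
have [lt_jk|lt_kj|/val_inj ejk] := ltngtP j k.
- by have := std_m j k lt_jk; rewrite jk_m.
- by have := std_m' k j lt_kj; rewrite kj_m'.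
- by rewrite ejk eqxx in jk.
Qed.

Local Notation gt := (B_var_gt l_gt0).

Lemma edge_gt_trans (e1 e2 e3 : B_edge l) : edge_gt e1 e2 -> edge_gt e2 e3 -> edge_gt e1 e3.
Proof. by rewrite /edge_gt /=; lia. Qed.

Lemma edge_gt_total (e1 e2 : B_edge l) : [|| edge_gt e1 e2, edge_gt e2 e1 | e1 == e2].
Proof.
rewrite orbA /edge_gt /=.
have [et|/eqP nt] := eqVneq (tag e1 : nat) (tag e2); last first.
  apply/orP; left.
  by move: (tagged e1 : nat) (tagged e2 : nat) (tag e1 : nat) (tag e2 : nat) nt; lia.
have [ep|/eqP np] := eqVneq (tagged e1 : nat) (tagged e2); last first.
  apply/orP; left.
  by move: (tagged e1 : nat) (tagged e2 : nat) np (tag e1 : nat) (tag e2 : nat); lia.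
suff e12 : e1 = e2 by apply/orP; right; apply/eqP.
case: e1 e2 et ep => [j p] [j' p'] /= /val_inj ej; case: j' / ej p' => p' ep.
by congr Tagged; apply: val_inj.
Qed.

Lemma lex_lt_trans m1 m2 m3 : lex_lt gt m1 m2 -> lex_lt gt m2 m3 -> lex_lt gt m1 m3.
Proof.
case=> x lt12 eq12 [y lt23 eq23].
case/or3P: (edge_gt_total (var_edge x) (var_edge y)) => [xy|yx|/eqP/enum_val_inj xy].
- exists x => [|z zx]; first by rewrite -eq23.
  by rewrite eq12 // eq23 //; apply: edge_gt_trans xy.
- exists y => [|z zy]; first by rewrite eq12.
  by rewrite eq12 ?eq23 //; apply: edge_gt_trans zy yx.
- exists x => [|z zx]; first by apply: ltn_trans lt12 _; rewrite xy.
  by rewrite eq12 // eq23 // -xy.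
Qed.

Lemma lex_lt_irr m : ~ lex_lt gt m m.
Proof. by case=> x; rewrite ltnn. Qed.

(** The first edge of path j is the largest variable in which the two monomials
    differ. *)
Lemma lex_swap j k r : (j < k)%N ->
  lex_lt gt (odd_edges k + even_edges j + r)%MM (odd_edges j + even_edges k + r)%MM.
Proof.
move=> lt_jk; exists (start_edge j).
  rewrite !mnmDE !odd_edgesE !even_edgesE /= !andbF !andbT eqxx.
  by have -> : (j == k) = false by apply/eqP => e; rewrite e ltnn in lt_jk.
move=> x; have [i [p ->]] := edge_varP x.
rewrite /B_var_gt -!/(var_edge _) !edge_varK /edge_gt /= => gt_x.
have [p0 lt_ij] : p = 0 :> nat /\ (i < j)%N by lia.
rewrite !mnmDE !odd_edgesE !even_edgesE p0 !andbF !andbT.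
have -> : (i == k) = false by apply/eqP => e; move: lt_ij lt_jk; rewrite e; lia.
by have -> : (i == j) = false by apply/eqP => e; move: lt_ij; rewrite e ltnn.
Qed.

End ToricIdeal.

(** * The toric ideal and its initial ideal *)

Section Ideals.

Variables (K : fieldType) (h : nat) (l : 'I_h -> nat) (l_gt0 : forall j, (0 < l j)%N).
Local Notation G := (B_graph l_gt0).
Local Notation n := #|edge G|.
Local Notation R := {mpoly K[n]}.
Local Notation gt := (B_var_gt l_gt0).
Implicit Types (j k : 'I_h) (m : 'X_{1..n}) (f p : R).

Definition odd_mono j : R := 'X_[odd_edges l_gt0 j].
Definition even_mono j : R := 'X_[even_edges l_gt0 j].

(** The ideal generated by the minors a_j b_k - a_k b_j, or by the monomials a_j
    b_k with j < k when [eps = false]. *)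
Definition minor_ideal eps p := exists v, en_aug eps odd_mono even_mono v = p.

Definition vdeg_mnm m : 'X_{1..#|vertex G|} :=
  [multinom vdeg m (enum_val y) | y < #|vertex G|].

Local Notation toric := (@toric_map K G).

Lemma toric_map_additive : {morph toric : f g / f - g}.
Proof. exact: comp_mpolyB. Qed.

HB.instance Definition _ := GRing.isAdditive.Build _ _ toric toric_map_additive.

Lemma toric_map_sum (J : Type) (r : seq J) (P : pred J) (F : J -> R) :
  toric (\sum_(i <- r | P i) F i) = \sum_(i <- r | P i) toric (F i).
Proof. exact: raddf_sum. Qed.

Lemma toric_mapM : {morph toric : f g / f * g}.
Proof. exact: rmorphM. Qed.

Lemma toric_mapZ c f : toric (c *: f) = c *: toric f.
Proof. exact: comp_mpolyZ. Qed.

Lemma toric_mapX m : toric 'X_[K, m] = 'X_[vdeg_mnm m].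
Proof.
rewrite /toric_map comp_mpolyX.
under eq_bigr => x _.
  rewrite tnth_mktuple -(big_morph _ (@mpolyXD _ _) (@mpolyX0 _ _)) mpolyXn.
  over.
rewrite -(big_morph _ (@mpolyXD _ _) (@mpolyX0 _ _)); congr mpolyX.
apply/mnmP => y; rewrite mnm_sumE mnmE; apply: eq_bigr => x _.
rewrite mulmnE mulnC; congr (_ * _)%N; rewrite mnm_sumE.
under eq_bigr => v _ do rewrite mnm1E.
have [yx|yNx] := boolP (_ \in _); last first.
  rewrite big1 // => v vx; case: eqP => // vy.
  by rewrite -vy enum_rankK vx in yNx.
rewrite (bigD1 (enum_val y)) //= enum_valK eqxx big1 // => v /andP[_ ne].
by case: eqP => // vy; rewrite -vy enum_rankK eqxx in ne.
Qed.

Lemma vdeg_mnmE m m' : vdeg m =1 vdeg m' <-> vdeg_mnm m = vdeg_mnm m'.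
Proof.
split=> [eq_v | /mnmP eq_v v]; first by apply/mnmP => y; rewrite !mnmE eq_v.
by have := eq_v (enum_rank (v : vertex G)); rewrite !mnmE enum_rankK.
Qed.

Lemma minor_ideal_linear eps x p q :
  minor_ideal eps p -> minor_ideal eps q -> minor_ideal eps (x * p + q).
Proof.
by case=> u <- [v <-]; exists (fun S i => x * u S i + v S i); rewrite en_aug_linear.
Qed.

Lemma minor_ideal0 eps : minor_ideal eps 0.
Proof.
exists (fun _ _ => 0); rewrite en_augE big1 // => j _; rewrite big1 // => k _.
by rewrite mulr0.
Qed.

Lemma minor_ideal_gen eps x j k : (j < k)%N ->
  minor_ideal eps
    (x * (odd_mono j * even_mono k - eps%:R * (odd_mono k * even_mono j))).
Proof.
move=> lt_jk; exists (fun S _ => if S == [set j; k] then x else 0).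
have set2E (i i' : 'I_h) : (i < i')%N -> ([set i; i'] == [set j; k]) = (i == j) && (i' == k).
  move=> lt_i; apply/eqP/andP => [/setP eq_jk|[/eqP-> /eqP->] //].
  have := eq_jk i; have := eq_jk i'; rewrite !inE !eqxx orbT /= => /esym ei' /esym ei.
  by split; move: ei ei' lt_i lt_jk; rewrite -!val_eqE /=; lia.
rewrite en_augE (bigD1 j) //= [X in _ + X]big1 ?addr0 => [|i ij]; last first.
  by rewrite big1 // => i' lt_i; rewrite set2E // (negbTE ij) mulr0.
rewrite (bigD1 k) //= [X in _ + X]big1 ?addr0 => [|i /andP[lt_i ik]]; last first.
  by rewrite set2E // (negbTE ik) andbF mulr0.
by rewrite eqxx mulrC.
Qed.

Lemma minor_ideal_toric p : minor_ideal true p -> toric p = 0.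
Proof.
case=> v <-; rewrite en_augE raddf_sum big1 // => j _.
rewrite raddf_sum big1 // => k _; rewrite /= toric_mapM raddfB /= mul1r.
rewrite /odd_mono /even_mono -!mpolyXD.
rewrite !toric_mapX.
have /vdeg_mnmE -> : vdeg (odd_edges l_gt0 j + even_edges l_gt0 k)%MM =1
    vdeg (odd_edges l_gt0 k + even_edges l_gt0 j)%MM by exact: vdeg_swap.
by rewrite subrr mul0r.
Qed.

(** Replacing a_j b_k by a_k b_j, for j < k, lowers the weight, so it stops; it
    preserves the image and descends lexicographically. *)
Lemma reduce_monomial m : exists m', [/\ standard m', vdeg m' =1 vdeg m,
  m' = m \/ lex_lt gt m' m & minor_ideal true ('X_[m] - 'X_[m'])].
Proof.
have [N] := ubnP (second_edge_wt m); elim: N m => // N IHN m; rewrite ltnS => le_N.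
have [|std_m] := pickP (fun jk : 'I_h * 'I_h => (jk.1 < jk.2)%N &&
  (odd_edges l_gt0 jk.1 + even_edges l_gt0 jk.2 <= m)%MM); last first.
  exists m; split=> //; last by rewrite subrr; apply: minor_ideal0.
    by move=> j k lt_jk; have := std_m (j, k); rewrite /= lt_jk /= => ->.
  by left.
case=> j k /= /andP[lt_jk /submK].
set r := (m - _)%MM => mE; rewrite addmC in mE.
have [|m' [std_m' v_m' lex_m' J_m']] :=
    IHN (odd_edges l_gt0 k + even_edges l_gt0 j + r)%MM.
  move: le_N; rewrite -mE !second_edge_wtD !wt_odd_edges !wt_even_edges; lia.
exists m'; split=> //.
- by move=> v; rewrite v_m' -mE !(vdegD _ r) vdeg_swap.
- right; have := lex_swap r lt_jk; rewrite mE.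
  by case: lex_m' => [-> //|]; apply: lex_lt_trans.
have := minor_ideal_linear 1 (minor_ideal_gen true 'X_[r] lt_jk) J_m'.
rewrite mul1r mul1r /odd_mono /even_mono mulrBr -!mpolyXD -mE.
rewrite ![(r + _)%MM]addmC addrA subrK.
by [].
Qed.

Lemma normal_form f :
  exists2 g, minor_ideal true (f - g) & forall m, m \in msupp g -> standard m.
Proof.
elim/mpolyind: f => [|c m f _ _ [g Jg std_g]].
  by exists 0; [rewrite subrr; apply: minor_ideal0 | move=> m; rewrite msupp0].
have [m' [std_m' _ _ J_m']] := reduce_monomial m.
exists (c *: 'X_[m'] + g) => [|m'' /msuppD_le].
  have := minor_ideal_linear c%:MP J_m' Jg; rewrite mul_mpolyC scalerBr.
  by rewrite addrACA -opprD.
rewrite mem_cat => /orP[/msuppZ_le|/std_g //].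
by rewrite msuppX inE => /eqP->.
Qed.

Lemma mcoeff_toric f m :
  (toric f)@_(vdeg_mnm m) =
  \sum_(m' <- msupp f | vdeg_mnm m' == vdeg_mnm m) f@_m'.
Proof.
rewrite {1}[f]mpolyE toric_map_sum (raddf_sum (mcoeff _)) [RHS]big_mkcond /=.
apply: eq_bigr => m' _; rewrite toric_mapZ toric_mapX.
by rewrite mcoeffZ mcoeffX; case: eqP; rewrite ?mulr1 ?mulr0.
Qed.

(** Modulo the minors an element of the toric ideal equals a combination of
    standard monomials that is again in the toric ideal. Standard monomials have
    distinct images, so the combination is 0. *)
Lemma toric_ideal_minors p : toric_ideal (G := G) p <-> minor_ideal true p.
Proof.
split=> [toric_p|/minor_ideal_toric //].
have [g J_pg std_g] := normal_form p.
suff g0 : g = 0 by move: J_pg; rewrite g0 subr0.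
have toric_g : toric g = 0.
  by rewrite -[g](subKr p) raddfB /= toric_p (minor_ideal_toric J_pg) subrr.
apply/mpolyP => m; rewrite mcoeff0; apply/eqP; rewrite -[_ == _]negbK -mcoeff_msupp.
apply/negP => m_g; have := mcoeff_toric g m; rewrite toric_g mcoeff0.
rewrite -big_filter (_ : [seq _ <- _ | _] = [seq m' <- msupp g | m' == m]); last first.
  apply: eq_in_filter => m' m'_g; apply/eqP/eqP => [/vdeg_mnmE eq_v|-> //].
  by apply: standard_unique; [exact: eq_v | exact: std_g | exact: std_g].
rewrite big_filter -big_filter filter_pred1_uniq // big_seq1 => g_m.
by move: m_g; rewrite mcoeff_msupp -g_m eqxx.
Qed.

(** The coefficients of [f] over the fibre of [m] add up to 0, so another
    monomial of [f] lies in that fibre, below [m]. Were [m] standard, this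
    monomial would reduce to [m], though reduction only descends. *)
Lemma leading_nonstandard f m : toric f = 0 -> leading_monomial gt f m ->
  exists j k, (j < k)%N /\ (odd_edges l_gt0 j + even_edges l_gt0 k <= m)%MM.
Proof.
move=> toric_f [m_f lead_m].
have [[j k] /andP[lt_jk le_m]|none] := pickP (fun jk : 'I_h * 'I_h => (jk.1 < jk.2)%N &&
  (odd_edges l_gt0 jk.1 + even_edges l_gt0 jk.2 <= m)%MM); first by exists j, k.
have std_m : standard m.
  by move=> j k lt_jk; have := none (j, k); rewrite /= lt_jk /= => ->.
have [m' m'_f /andP[ne_m' /eqP v_m']] : exists2 m', m' \in msupp f &
    (m' != m) && (vdeg_mnm m' == vdeg_mnm m).
  apply/hasP; apply: contraT => /hasPn no_m'.
  have := mcoeff_toric f m; rewrite toric_f mcoeff0 big_mkcond (bigD1_seq m) //= eqxx.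
  rewrite big1_seq ?addr0 => [f_m|m' /andP[ne /no_m']]; last by rewrite ne /= => /negbTE->.
  by move: m_f; rewrite mcoeff_msupp -f_m eqxx.
have [m'' [std_m'' v_m'' lex_m'' _]] := reduce_monomial m'.
have m''E : m'' = m.
  apply: standard_unique => // v; rewrite v_m''.
  by move: v; apply/vdeg_mnmE.
have lt_m' := lead_m m' m'_f ne_m'.
rewrite m''E in lex_m''; case: lex_m'' => [e|lt_m]; first by rewrite e eqxx in ne_m'.
by case: (@lex_lt_irr _ _ l_gt0 m); apply: lex_lt_trans lt_m lt_m'.
Qed.

Lemma leading_minor j k : (j < k)%N ->
  leading_monomial gt (odd_mono j * even_mono k - odd_mono k * even_mono j)
    (odd_edges l_gt0 j + even_edges l_gt0 k)%MM.
Proof.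
move=> lt_jk; have := @lex_swap _ _ l_gt0 _ _ 0%MM lt_jk; rewrite !addm0 => lt_m.
rewrite /odd_mono /even_mono -!mpolyXD; split.
  rewrite mcoeff_msupp mcoeffB !mcoeffX eqxx; case: (_ =P _ :> 'X_{1..n}) => [e|_].
    by rewrite e in lt_m; case: (lex_lt_irr lt_m).
  by rewrite subr0 oner_neq0.
by move=> m' /msuppB_le; rewrite mem_cat !msuppX !inE => /orP[->//|/eqP-> _].
Qed.

Lemma initial_ideal_minors p :
  initial_ideal gt (toric_ideal (G := G)) p <-> minor_ideal false p.
Proof.
split=> [[s [gen_s ->]]|[v <-]].
  elim: s gen_s => [|[c g] s IHs] gen_s; first by rewrite big_nil; apply: minor_ideal0.
  rewrite big_cons; apply: minor_ideal_linear; last first.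
    by apply: IHs => cg cg_s; apply: gen_s; rewrite inE cg_s orbT.
  have [|f [m [toric_f lead_m ->]]] := gen_s (c, g); first by rewrite inE eqxx.
  have [j [k [lt_jk /submK]]] := leading_nonstandard toric_f lead_m.
  set r := (m - _)%MM => <-; have := minor_ideal_gen false 'X_[r] lt_jk.
  by rewrite mul0r subr0 /odd_mono /even_mono -!mpolyXD.
exists [seq (v [set jk.1; jk.2] 0%N, odd_mono jk.1 * even_mono jk.2) |
  jk : 'I_h * 'I_h <- enum [pred jk : 'I_h * 'I_h | (jk.1 < jk.2)%N]]; split.
  move=> _ /mapP[[j k] + ->]; rewrite mem_enum inE /= => lt_jk.
  exists (odd_mono j * even_mono k - odd_mono k * even_mono j).
  exists (odd_edges l_gt0 j + even_edges l_gt0 k)%MM; split.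
  - apply/toric_ideal_minors; have := minor_ideal_gen true 1 lt_jk.
    by rewrite !mul1r.
  - exact: leading_minor.
  - by rewrite /odd_mono /even_mono mpolyXD.
rewrite big_map big_enum /= en_augE pair_big_dep /=.
by apply: eq_bigr => -[j k] _ /=; rewrite mul0r subr0 mulrC.
Qed.

End Ideals.

(** * Counting the basis of the resolution *)

Local Open Scope nat_scope.

Section Counting.

Variables (h : nat) (l : 'I_h -> nat).

Definition subsets_of_weight i j : {set {set 'I_h}} :=
  [set S : {set 'I_h} | (#|S| == i.+2) && (\sum_(k in S) l k == j)].

Lemma card_en_basis i j :
  #|[pred x : 'I_(en_rank h i) | en_deg l x == j]| = i.+1 * #|subsets_of_weight i j|.
Proof.
pose f (x : 'I_(en_rank h i)) := val (enum_val x).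
have inj_f : injective f by move=> x y /val_inj/enum_val_inj.
rewrite -(card_imset _ inj_f).
have -> : f @: [pred x | en_deg l x == j] =
          setX (subsets_of_weight i j) [set p : 'I_h | p <= i].
  apply/setP => -[S p]; rewrite !inE /=; apply/imsetP/idP => [[x]|].
    rewrite inE => deg_x fx; have := basis_index x; rewrite /en_index /basis_set /basis_pos.
    by move: deg_x; rewrite /en_deg /basis_set -[val _]/(f x) -fx /= => -> /andP[-> ->].
  case/andP=> /andP[sS deg_S] le_p.
  have Sp : en_index i S p by rewrite /en_index sS.
  exists (enum_rank (exist _ (S, p) Sp : en_basis h i)); last by rewrite /f enum_rankK.
  by rewrite inE /en_deg /basis_set enum_rankK.
rewrite cardsX mulnC; have [->|[S]] := set_0Vmem (subsets_of_weight i j).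
  by rewrite cards0 !muln0.
rewrite inE => /andP[/eqP sS _]; congr (_ * _).
have lt_i : i.+2 <= h by rewrite -sS -[X in _ <= X]card_ord max_card.
have -> : [set p : 'I_h | p <= i] = [set widen_ord (ltnW lt_i) p | p : 'I_i.+1].
  apply/setP => p; rewrite inE; apply/idP/imsetP => [le_p|[p' _ ->]].
    by exists (Ordinal (le_p : p < i.+1)) => //; apply: val_inj.
  by have := ltn_ord p'.
by rewrite card_imset ?card_ord // => p p' /(congr1 val) /= /val_inj.
Qed.

Lemma card_subsets_const l0 i j : (forall k, l k = l0) ->
  #|subsets_of_weight i j| = if j == l0 * (i + 2) then 'C(h, i + 2) else 0.
Proof.
move=> l_const; rewrite !addn2.
have wtE (S : {set 'I_h}) : \sum_(k in S) l k = l0 * #|S|.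
  by rewrite mulnC -sum_nat_const; apply: eq_bigr.
case: eqP => [->|ne_j]; last first.
  apply/eqP; rewrite cards_eq0; apply/eqP/setP => S; rewrite !inE wtE.
  by apply/andP => -[/eqP-> /eqP/esym].
rewrite -[in RHS](card_ord h) -card_draws; apply: eq_card => S; rewrite !inE wtE.
by case: eqP => //= ->; rewrite eqxx.
Qed.

(** The sum of the [l k] over S depends only on the size of S and on whether S
    contains the exceptional path; Pascal's rule counts the sets that do. *)
Lemma card_subsets_one l0 q i j : 0 < h -> q <> l0 ->
    (forall k : 'I_h, l k = if k == 0 :> nat then q else l0) ->
  #|subsets_of_weight i j| = if j == l0 * (i + 2) then 'C(h - 1, i + 2)
    else if j == l0 * (i + 1) + q then 'C(h - 1, i + 1) else 0.
Proof.
move=> h_gt0 ne_q lE; rewrite !addn2 !addn1; pose z := Ordinal h_gt0.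
have wtE (S : {set 'I_h}) : \sum_(k in S) l k =
    if z \in S then l0 * #|S|.-1 + q else l0 * #|S|.
  have sumC (T : {set 'I_h}) : z \notin T -> \sum_(k in T) l k = l0 * #|T|.
    move=> zT; rewrite mulnC -sum_nat_const; apply: eq_bigr => k kT.
    by rewrite lE; case: eqP => // k0; case/negP: zT; rewrite (_ : z = k) //; apply: val_inj.
  case: ifP => [zS|/negbT/sumC //]; rewrite (bigD1 z) //= lE /= addnC; congr (_ + _).
  rewrite (eq_bigl (mem (S :\ z))) => [|k]; last by rewrite !inE andbC.
  by rewrite sumC ?setD11 // (cardsD1 z S) zS.
have card_out : #|[set S : {set 'I_h} | (#|S| == i.+2) & z \notin S]| = 'C(h - 1, i.+2).
  have <- : #|~: [set z]| = h - 1 by rewrite cardsC1 card_ord subn1.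
  rewrite -cards_draws; apply: eq_card => S; rewrite !inE andbC; congr (_ && _).
  by rewrite subsetC sub1set inE.
have card_in : #|[set S : {set 'I_h} | (#|S| == i.+2) & z \in S]| = 'C(h - 1, i.+1).
  have := card_draws 'I_h i.+2; rewrite card_ord -(cardsID [set S : {set 'I_h} | z \in S]).
  have -> : 'C(h, i.+2) = 'C(h - 1, i.+2) + 'C(h - 1, i.+1).
    by have := h_gt0; case: (h) => // h' _; rewrite binS subn1.
  have -> : [set S : {set 'I_h} | #|S| == i.+2] :\: [set S : {set 'I_h} | z \in S] =
            [set S : {set 'I_h} | (#|S| == i.+2) & z \notin S].
    by apply/setP => S; rewrite !inE andbC.
  have -> : [set S : {set 'I_h} | #|S| == i.+2] :&: [set S : {set 'I_h} | z \in S] =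
            [set S : {set 'I_h} | (#|S| == i.+2) & z \in S].
    by apply/setP => S; rewrite !inE.
  by rewrite card_out addnC => /addnI.
have ne_wt : (l0 * i.+1 + q == l0 * i.+2) = false.
  by rewrite [l0 * i.+2]mulnS addnC eqn_add2r; apply/eqP.
have [-> | ne_j] := eqVneq j (l0 * i.+2).
  rewrite -card_out; apply: eq_card => S; rewrite !inE wtE.
  by case: eqP => //= ->; case: (z \in S); rewrite ?eqxx ?ne_wt.
have [-> | ne_j'] := eqVneq j (l0 * i.+1 + q).
  rewrite -card_in; apply: eq_card => S; rewrite !inE wtE.
  by case: eqP => //= ->; case: (z \in S); rewrite ?eqxx // eq_sym ne_wt.
apply/eqP; rewrite cards_eq0; apply/eqP/setP => S; rewrite !inE wtE.
apply/andP => -[/eqP-> /=]; case: (z \in S) => /eqP e.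
  by rewrite -e eqxx in ne_j'.
by rewrite -e eqxx in ne_j.
Qed.

End Counting.

Section Betti.

Variables (K : fieldType) (h : nat) (l : 'I_h -> nat) (l_gt0 : forall j, 0 < l j).
Local Notation G := (B_graph l_gt0).

Lemma betti_minor_ideal eps (I : {mpoly K[#|edge G|]} -> Prop) i j :
    (forall p, I p <-> minor_ideal eps p) ->
  betti I i j = i.+1 * #|subsets_of_weight l i j|.
Proof.
move=> I_minors; rewrite -card_en_basis.
by apply: (betti_en (A := odd_edges l_gt0) (B := even_edges l_gt0)
  (path := fun x => tag (var_edge x)) (wt := second_edge_wt (l_gt0 := l_gt0))
  _ _ _ _ l_gt0 _ _ I_minors)
   => ?; [exact: odd_edges_path | exact: even_edges_path | exact: wt_odd_edges
    | exact: wt_even_edges | exact: mdeg_odd_edges | exact: mdeg_even_edges].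
Qed.

End Betti.

Theorem theorem4p7 (K : fieldType) (h : nat) (h_ge2 : 2 <= h)
    (l : 'I_h -> nat) (l_gt0 : forall j : 'I_h, 0 < l j) :
  let I : {mpoly K[#|edge (B_graph l_gt0)|]} -> Prop :=
    @toric_ideal K (B_graph l_gt0) in
  let inI := initial_ideal (B_var_gt l_gt0) I in
  (forall l0 : nat, (forall k : 'I_h, l k = l0) ->
     forall i j : nat,
       betti I i j = betti inI i j /\
       betti inI i j =
         if j == l0 * (i + 2) then (i + 1) * 'C(h, i + 2) else 0) /\
  (forall q l0 : nat, q <> l0 ->
     (forall k : 'I_h, l k = if (k : nat) == 0 then q else l0) ->
     forall i j : nat,
       betti I i j = betti inI i j /\
       betti inI i j =
         if j == l0 * (i + 2) then (i + 1) * 'C(h - 1, i + 2)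
         else if j == l0 * (i + 1) + q then (h - 1) * 'C(h - 2, i)
         else 0).
Proof.
move=> I inI; have bettiE i j : betti I i j = betti inI i j /\
    betti inI i j = i.+1 * #|subsets_of_weight l i j|.
  rewrite (betti_minor_ideal _ _ (@toric_ideal_minors K h l l_gt0)).
  by rewrite (betti_minor_ideal _ _ (@initial_ideal_minors K h l l_gt0)).
split=> [l0 l_const i j | q l0 ne_q lE i j]; have [-> ->] := bettiE i j; split=> //.
  by rewrite (card_subsets_const _ _ l_const) addn1; case: eqP; rewrite ?muln0.
rewrite (card_subsets_one _ _ (ltnW h_ge2) ne_q lE) [i + 1]addn1.
case: eqP => // _; case: eqP => _; rewrite ?muln0 //.
by rewrite -mul_bin_diag subn1 subn2.
Qed.
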